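(* Let $k \ge 2$ be an integer, $n = 2^k-1$, and $d \ge 1$. Choose $s_1,\dots,s_d$ independently and uniformly at random in $\mathit{GL}_k(\mathbb{F}_2)$ and let $G$ be the bipartite Schreier graph whose left and right parts are two copies of $(\mathbb{F}_2^k)^* = \mathbb{F}_2^k\setminus\{0\}$, where for every nonzero $x$ and every $j$ the left copy of $x$ is joined to the right copy of $s_j x$ (a $d$-regular bipartite multigraph with $2n$ vertices). Let $\mu_2$ be the second largest eigenvalue of its normalized adjacency matrix (adjacency matrix divided by $d$), in the sense of the context below. For integers $p \ge 1$, $c\ge 0$, $l \ge 0$, $d'\ge 0$ define recursively $$ Y_p(c,l, d') = \begin{cases} 1 & \text{if } c = 0 \text{ and } l = 0;\\ 0 & \text{if } p > l;\\ \displaystyle\sum_{i = c}^{\lfloor l/p\rfloor} \binom{d'}{i}(p!)^{-i}\frac{l!}{(l-pi)!}\,Y_{p+1}(0,l-pi, d'-i) & \text{otherwise,} \end{cases} $$ (with $\binom{d'}{i}=0$ for $i>d'$), and set $y_3(i) = Y_3(1,2m-2i, d-i)$, $y_4(i) = Y_4(0,2m-2i, d-i)$. Then for every positive integer $m$, \begin{multline*} \mathbf{E}(|\mu_2|) \le \Bigg(\Big(\frac{1}{d}\Big)^{2m}n\bigg[ \sum_{i = 1}^m \bigg[\binom{d}{i} \Big(\frac{1}{2}\Big)^i \frac{(2m)!}{(2m-2i)!} \frac{2^i}{(i+1)!}\Big(y_3(i)\frac{5}{n} + y_4(i) \Big)\bigg] \\ + Y_1(1, 2m, d)\frac{1}{n}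 + Y_2(1, 2m, d)\frac{2}{n} + y_3(0)\frac{5}{n} + y_4(0)\bigg] - 1 \Bigg)^{\frac{1}{2m}}. \end{multline*}
   Context: For a bipartite biregular graph the eigenvalues of the normalized adjacency matrix come in pairs $\pm\lambda$; the largest pair is $\pm 1$. The ''second largest eigenvalue'' $\mu_2$ is the nonnegative member of the next pair, i.e. the largest absolute value among the eigenvalues after removing one copy of $1$ and one copy of $-1$. The expectation is over the random choice of $s_1,\dots,s_d$. *)

(* Defs.v *)
From mathcomp Require Import all_boot all_order all_algebra all_field.
Set Implicit Arguments. Unset Strict Implicit. Unset Printing Implicit Defensive.
Import Order.TTheory GRing.Theory Num.Theory.
Local Open Scope ring_scope.

(* The recursively defined quantity Y_p(c, l, d'), with a fuel argument
   (fuel l.+2 always suffices: p increases by one at each call and the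
   recursion stops once p > l). *)
Fixpoint Yf (fuel p c l d' : nat) : algC :=
  match fuel with
  | 0%N => 0
  | fuel'.+1 =>
    if (c == 0%N) && (l == 0%N) then 1
    else if (l < p)%N then 0
    else \sum_(c <= i < (l %/ p).+1)
           ('C(d', i)%:R * ((p`!)%:R ^- i) * ((l`!)%:R / ((l - p * i)`!)%:R)
             * Yf fuel' p.+1 0 (l - p * i) (d' - i))
  end.

Definition Y (p c l d' : nat) : algC := Yf l.+2 p c l d'.

Definition eigvals (N : nat) (A : 'M[algC]_N) : seq algC :=
  sval (closed_field_poly_normal (char_poly A)).

Definition mu2 (N : nat) (A : 'M[algC]_N) : algC :=
  \big[Num.max/0]_(x <- rem (-1) (rem 1 (eigvals A))) `|x|.

Definition nzvec (k : nat) := {x : 'cV['F_2]_k | x != 0}.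

Definition biadj (k d : nat) (s : {ffun 'I_d -> 'M['F_2]_k})
  : 'M[algC]_(#|{: nzvec k}|) :=
  \matrix_(i, j) ((#|[set j0 : 'I_d |
        s j0 *m val (enum_val i) == val (enum_val j)]|)%:R / d%:R).

Definition schreier_adj (k d : nat) (s : {ffun 'I_d -> 'M['F_2]_k})
  : 'M[algC]_(#|{: nzvec k}| + #|{: nzvec k}|) :=
  block_mx 0 (biadj s) (biadj s)^T 0.

Definition GLtuples (k d : nat) : {set {ffun 'I_d -> 'M['F_2]_k}} :=
  [set s : {ffun 'I_d -> 'M['F_2]_k} | [forall j, s j \in unitmx]].

Definition E_mu2 (k d : nat) : algC :=
  (#|GLtuples k d|%:R)^-1 *
    \sum_(s in GLtuples k d) `|mu2 (schreier_adj s)|.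

Definition bound (k d m : nat) : algC :=
  let n : algC := (2 ^ k - 1)%:R in
  let y3 i := Y 3 1 (2 * m - 2 * i) (d - i) in
  let y4 i := Y 4 0 (2 * m - 2 * i) (d - i) in
  (2 * m).-root
   ((d%:R ^-1) ^+ (2 * m) * n *
      ( \sum_(1 <= i < m.+1)
           ('C(d, i)%:R * (2%:R ^-1) ^+ i
             * ((2 * m)`!)%:R / ((2 * m - 2 * i)`!)%:R
             * (2%:R ^+ i / (i.+1)`!%:R)
             * (y3 i * 5%:R / n + y4 i))
        + Y 1 1 (2 * m) d / n + Y 2 1 (2 * m) d * 2%:R / n
        + y3 0%N * 5%:R / n + y4 0%N)
    - 1).

(* Main.v *)
Require Import Defs.
From mathcomp Require Import all_boot all_order all_algebra all_field.
From mathcomp Require Import zify ring.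
Set Implicit Arguments. Unset Strict Implicit. Unset Printing Implicit Defensive.
Import Order.TTheory GRing.Theory Num.Theory.
Local Open Scope ring_scope.

(** Trace method. The spectrum is symmetric and contains 1 and -1, so [mu2 ^ (2m)] is at most
    [tr ((B B^T)^m) - 1] for the biadjacency matrix [B], and this trace counts, over the words of
    length [2m] with alternating signs, the nonzero vectors fixed by the word. Resampling a single
    generator, the expected number of fixed vectors is at most 1 if some letter occurs once, 2 if two
    letters occurring twice cross (or one of them repeats its sign), 5 if some letter occurs three
    times, and [n] in any case: linear relations are preserved by [GL_k], which acts transitively on
    independent triples. Words are counted by exponential generating functions; the letters
    occurring exactly twice without crossing form a labelled parenthesization, which a stack
    reads. *)

(** * Spectra of bipartite matrices *)

(** Signs alternate along a word, so a generator can cancel against its inverse: a word made of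
    nested pairs alone may be the identity, and nothing better than [n] holds for it. Hence the
    noncrossing pairs are set apart and counted by ballot numbers, and the letters outside them,
    which occur at least three times, decide between 5 and [n]. A crossing prevents the
    cancellation, but when the repeated letter changes sign, resampling it alone is not enough,
    because the outer factor may still fix every vector; the second crossing letter supplies the
    missing average. The constants come from summing over the intermediate vectors visited by the
    resampled letter. Prescribing one, two or three independent images costs successive factors [n],
    [n - 1], [n - 3], which the number of admissible intermediate vectors compensates up to a
    constant. The estimate for a single word is a sum of nonnegative terms over all candidate sets
    of paired letters. Overcounting is harmless, and each term is a product of a condition inside
    the set and one outside it, so the sum over words factors. *)

Lemma char_poly_conj (F : fieldType) n (P A : 'M[F]_n) :
  P \in unitmx -> char_poly (invmx P *m A *m P) = char_poly A.
Proof.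
move=> uP; rewrite /char_poly.
have -> : char_poly_mx (invmx P *m A *m P)
    = map_mx polyC (invmx P) *m char_poly_mx A *m map_mx polyC P.
  rewrite /char_poly_mx mulmxBr mulmxBl mul_mx_scalar.
  by rewrite -scalemxAl -!map_mxM /= mulVmx // map_mx1 scalemx1.
rewrite !det_mulmx mulrAC -det_mulmx -map_mxM mulVmx // map_mx1 det1 mul1r.
by [].
Qed.

Lemma eigvalsE n (A : 'M[algC]_n) :
  \prod_(x <- eigvals A) ('X - x%:P) = char_poly A.
Proof.
rewrite /eigvals; case: closed_field_poly_normal => r /= ->.
by rewrite (monicP (char_poly_monic A)) scale1r.
Qed.

Lemma eigvals_perm n (A B : 'M[algC]_n) :
  char_poly A = char_poly B -> perm_eq (eigvals A) (eigvals B).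
Proof. by move=> eAB; apply: prod_XsubC_eq; rewrite !eigvalsE. Qed.

Lemma mem_eigvals n (A : 'M[algC]_n) x : (x \in eigvals A) = eigenvalue A x.
Proof. by rewrite eigenvalue_root_char -eigvalsE root_prod_XsubC. Qed.

Lemma eigvals_diag n (v : 'rV[algC]_n) :
  perm_eq (eigvals (diag_mx v)) [seq v 0 i | i <- enum 'I_n].
Proof.
apply: prod_XsubC_eq; rewrite eigvalsE char_poly_trig ?diag_mx_is_trig //.
rewrite big_map big_enum /=; apply: eq_bigr => i _.
by rewrite mxE eqxx.
Qed.

Lemma expmx_conj n (P A : 'M[algC]_n) p : P \in unitmx ->
  (invmx P *m A *m P) ^+ p = invmx P *m A ^+ p *m P.
Proof.
move=> uP; elim: p => [|p IH]; first by rewrite !expr0 mulmx1 mulVmx.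
by rewrite !exprS IH -!mulmxE !mulmxA mulmxK.
Qed.

Lemma expmx_diag n (v : 'rV[algC]_n) p :
  diag_mx v ^+ p = diag_mx (\row_i (v 0 i ^+ p)).
Proof.
elim: p => [|p IH].
  by apply/matrixP=> i j; rewrite expr0 !mxE.
rewrite exprS IH -mulmxE mulmx_diag.
by congr diag_mx; apply/rowP => i; rewrite !mxE exprS.
Qed.

Lemma spectral_perm n (A : 'M[algC]_n) : A \is hermsymmx ->
  perm_eq (eigvals A) [seq spectral_diag A 0 i | i <- enum 'I_n].
Proof.
move=> hA; have /orthomx_spectralP eA := hermitian_normalmx hA.
rewrite {1}eA; apply: perm_trans (eigvals_diag _).
by apply: eigvals_perm; rewrite char_poly_conj // spectral_unit.
Qed.

Lemma trace_exp_eigvals n (A : 'M[algC]_n) p : A \is hermsymmx ->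
  \tr (A ^+ p) = \sum_(x <- eigvals A) x ^+ p.
Proof.
move=> hA; have /orthomx_spectralP eA := hermitian_normalmx hA.
rewrite (perm_big _ (spectral_perm hA)) big_map big_enum /=.
rewrite {1}eA expmx_conj ?spectral_unit // mxtrace_mulC mulKVmx ?spectral_unit //.
by rewrite expmx_diag mxtrace_diag; apply: eq_bigr => i _; rewrite mxE.
Qed.

Lemma eigvals_real n (A : 'M[algC]_n) : A \is hermsymmx ->
  {in eigvals A, forall x, x \is Num.real}.
Proof.
move=> hA x; rewrite (perm_mem (spectral_perm hA)) => /mapP[i _ ->].
exact: mxOverP (hermitian_spectral_diag_real hA) _ _.
Qed.

Lemma char_polyN n (A : 'M[algC]_n) :
  char_poly (- A) = (-1) ^+ n *: (char_poly A \Po - 'X).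
Proof.
rewrite /char_poly -det_map_mx -[(-1) ^+ _ *: _]mul_polyC rmorphXn /= rmorphN1 -detZ.
suff -> : char_poly_mx (- A) = -1 *: map_mx (comp_poly (- 'X)) (char_poly_mx A) by [].
apply/matrixP => i j; rewrite !mxE mulN1r comp_polyB comp_polyC polyCN opprB opprK addrC.
by congr (_ + _); case: (i == j); rewrite ?mulr1n ?mulr0n ?comp_polyX ?comp_poly0 ?opprK ?oppr0.
Qed.

Section Bip.
Variables (n : nat) (B : 'M[algC]_n).
Let A := block_mx 0 B B^T 0.

(** Conjugation by the block matrix [diag(1, -1)] turns [A] into [- A], so the two have the same
    characteristic polynomial. *)
Lemma bip_eigvalsN : perm_eq (eigvals A) [seq - x | x <- eigvals A].
Proof.
pose P : 'M[algC]_(n + n) := block_mx 1%:M 0 0 (- 1%:M).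
have PP : P *m P = 1%:M.
  rewrite mulmx_block !mulmx0 !mul0mx !addr0 !add0r mul1mx mulmxN mulNmx mul1mx.
  by rewrite opprK -scalar_mx_block.
have uP : P \in unitmx by have /mulmx1_unit [] := PP.
have iP : invmx P = P by rewrite -[RHS](mulKmx uP) PP mulmx1.
have eP : invmx P *m A *m P = - A.
  rewrite iP !mulmx_block.
  rewrite !(mulmx0, mul0mx, mul1mx, mulmx1, addr0, add0r, mulNmx, mulmxN, oppr0).
  by rewrite /A opp_block_mx !oppr0.
have : perm_eq (eigvals A) (eigvals (- A)).
  by apply: eigvals_perm; rewrite -eP char_poly_conj.
move=> h; apply: (perm_trans h); apply: prod_XsubC_eq; rewrite big_map eigvalsE.
rewrite char_polyN.
rewrite -eigvalsE rmorph_prod /=.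
have -> : (-1) ^+ (n + n) = 1 :> algC by rewrite exprD -expr2 sqrr_sign.
rewrite scale1r.
have sz : size (eigvals A) = (n + n)%N.
  by apply/succn_inj; rewrite -(size_prod_XsubC _ id) eigvalsE size_char_poly.
transitivity (\prod_(x <- eigvals A) ((-1) * ('X - (- x)%:P)) : {poly algC}).
  apply: eq_bigr => x _; rewrite rmorphB /= comp_polyX comp_polyC.
  by rewrite polyCN opprK mulN1r opprD.
rewrite big_split /= big_const_seq count_predT iter_mulr mulr1 sz.
by rewrite exprD -expr2 sqrr_sign mul1r.
Qed.

(** Even powers of [A] are block diagonal, and the two blocks have equal traces by cyclicity. *)
Lemma bip_trace m : \tr (A ^+ (2 * m)) = 2%:R * \tr ((B *m B^T) ^+ m).
Proof.
have -> : A ^+ (2 * m) = block_mx ((B *m B^T) ^+ m) 0 0 ((B^T *m B) ^+ m).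
  elim: m => [|m IH].
    by rewrite muln0 !expr0 -[RHS]scalar_mx_block.
  rewrite mulnS exprD IH expr2 -!mulmxE /A !mulmx_block.
  by rewrite !(mulmx0, mul0mx, addr0, add0r) !exprS.
rewrite mxtrace_block; set x := \tr _.
suff -> : \tr ((B^T *m B) ^+ m) = x by ring.
rewrite /x; case: m {x} => [|m]; first by rewrite !expr0.
have E p : (B^T *m B) ^+ p *m B^T = B^T *m (B *m B^T) ^+ p.
  elim: p => [|p IH]; first by rewrite !expr0 mulmx1 mul1mx.
  by rewrite !exprS -!mulmxE -!mulmxA IH.
by rewrite exprSr -mulmxE mulmxA E -mulmxA mxtrace_mulC exprSr -mulmxE -mulmxA.
Qed.

Hypothesis Breal : B \is a mxOver Num.real.
Hypothesis Brow : forall i, \sum_j B i j = 1.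
Hypothesis Bcol : forall j, \sum_i B i j = 1.
Hypothesis n_gt0 : (0 < n)%N.

Lemma bip_herm : A \is hermsymmx.
Proof.
apply: realsym_hermsym.
  apply/is_hermitianmxP; rewrite expr0 scale1r map_mx_id // /A.
  by rewrite tr_block_mx !trmx0 trmxK.
apply/mxOverP => i j; rewrite /A.
case: (split_ordP i) => a ->; case: (split_ordP j) => b ->;
  rewrite ?block_mxEul ?block_mxEur ?block_mxEdl ?block_mxEdr ?mxE ?rpred0 //;
  exact: mxOverP.
Qed.

Lemma bip_eigen e : e * e = 1 -> e \in eigvals A.
Proof.
move=> ee; rewrite mem_eigvals; apply/eigenvalueP.
exists (row_mx (const_mx 1) (const_mx e)).
  rewrite /A mul_row_block !mulmx0 add0r addr0 scale_row_mx; congr row_mx.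
    apply/rowP => j; rewrite !mxE mulr1.
    under eq_bigr do rewrite !mxE. by rewrite -mulr_sumr Brow mulr1.
  apply/rowP => j; rewrite !mxE ee.
  by under eq_bigr do rewrite !mxE mul1r; rewrite Bcol.
apply/eqP => /rowP /(_ (lshift n (Ordinal n_gt0))).
rewrite row_mxEl !mxE => /eqP; rewrite oner_eq0 //.
Qed.

(** Removing 1 and -1 leaves a list that is still symmetric and whose [2 * m]-th powers sum to twice
    the right-hand side. A largest entry occurs together with its opposite, so it is counted twice
    and the factor 2 cancels. *)
Lemma mu2_le m : (0 < m)%N ->
  0 <= mu2 A /\ mu2 A ^+ (2 * m) <= \tr ((B *m B^T) ^+ m) - 1.
Proof.
move=> m_gt0; have hA := bip_herm.
have h1 : 1 \in eigvals A by apply: bip_eigen; rewrite mulr1.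
have N11 : (-1 : algC) != 1.
  by rewrite -subr_eq0 -opprD oppr_eq0 (pnatr_eq0 _ 2).
have h2 : -1 \in rem 1 (eigvals A).
  have /bip_eigen : (-1 : algC) * -1 = 1 by rewrite mulrNN mulr1.
  by rewrite (perm_mem (perm_to_rem h1)) inE (negPf N11).
pose L := rem (-1) (rem 1 (eigvals A)).
have pL : perm_eq (eigvals A) [:: 1, -1 & L].
  by rewrite (permPl (perm_to_rem h1)) perm_cons perm_to_rem.
have Lr : {in L, forall x, x \is Num.real}.
  by move=> x xL; apply: (eigvals_real hA); rewrite (perm_mem pL) !inE xL !orbT.
have LN : perm_eq L [seq - x | x <- L].
  have swap : perm_eq [:: -1, 1 & L] [:: 1, -1 & L].
    by apply/permPl; apply: (perm_catCA [:: -1] [:: 1] L).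
  have : perm_eq [:: -1, 1 & L] [seq - x | x <- [:: 1, -1 & L]].
    apply: perm_trans swap _; rewrite -(permPl pL).
    by apply: perm_trans bip_eigvalsN _; apply: perm_map.
  by rewrite /= opprK !perm_cons.
have Lsum : \sum_(x <- L) x ^+ (2 * m) = 2%:R * (\tr ((B *m B^T) ^+ m) - 1).
  have := trace_exp_eigvals (2 * m) hA; rewrite bip_trace (perm_big _ pL) /=.
  rewrite !big_cons expr1n exprM sqrrN expr1n expr1n => E.
  by rewrite mulrBr E; ring.
have Lpos x : x \in L -> 0 <= x ^+ (2 * m).
  by move=> xL; rewrite exprM exprn_ge0 // real_exprn_even_ge0 // Lr.
have LsumN : 0 <= \sum_(x <- L) x ^+ (2 * m).
  by rewrite big_seq sumr_ge0.
rewrite /mu2 -/L.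
have [->|[x xL ->]] : \big[Num.max/0]_(x <- L) `|x| = 0 \/
    (exists2 x, x \in L & \big[Num.max/0]_(x <- L) `|x| = `|x|).
- rewrite big_seq; elim/big_rec: _ => [|x y xL [->|[z zL ->]]]; first by left.
  + by right; exists x => //; rewrite /Num.max normr_lt0.
  + by right; rewrite /Num.max; case: ifP => _; [exists z|exists x].
- split=> //; rewrite expr0n muln_eq0 /= eqn0Ngt m_gt0 /=.
  by rewrite -(pmulr_rge0 _ (ltr0n _ 2)) -Lsum.
split=> //; rewrite -normrX ger0_norm ?Lpos //.
(* For [x = 0] the opposite entry is not a second entry; there it suffices that the power sum is
   nonnegative. *)
have [x0|x0] := eqVneq x 0.
  rewrite x0 expr0n muln_eq0 /= eqn0Ngt m_gt0 /=.
  by rewrite -(pmulr_rge0 _ (ltr0n _ 2)) -Lsum.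
rewrite -(ler_pM2l (ltr0n _ 2)) -Lsum (perm_big _ (perm_to_rem xL)) big_cons.
have NxL : - x \in rem x L.
  have : - x \in L by rewrite (perm_mem LN) map_f.
  rewrite (perm_mem (perm_to_rem xL)) inE => /orP[/eqP E|//].
  have /eqP : x *+ 2 = 0 by rewrite mulr2n -{1}E addNr.
  by rewrite mulrn_eq0 (negPf x0).
rewrite (perm_big _ (perm_to_rem NxL)) big_cons.
have -> : (- x) ^+ (2 * m) = x ^+ (2 * m) by rewrite exprM sqrrN -exprM.
rewrite /= addrA mulr_natl mulr2n lerDl big_seq sumr_ge0 // => y yL.
by apply: Lpos; apply: mem_rem; apply: mem_rem yL.
Qed.
End Bip.

(** * Counting invertible matrices with prescribed images *)

Section GLcount.
Variable k : nat.
Local Notation V := 'cV['F_2]_k.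
Local Notation M := 'M['F_2]_k.
Implicit Types (a b c x y z : V) (g h : M).

Definition GL : {set M} := [set g | g \in unitmx].
Definition nzcount : nat := (2 ^ k - 1)%N.

Lemma F2E (u : 'F_2) : (u == 0) || (u == 1).
Proof. by case: u => [[|[|]]]. Qed.

Lemma addvv m (x : 'cV['F_2]_m) : x + x = 0.
Proof.
apply/colP => i; rewrite !mxE.
by case/orP: (F2E (x i 0)) => /eqP ->; apply/eqP.
Qed.

Lemma oppv m (x : 'cV['F_2]_m) : - x = x.
Proof. by apply/eqP; rewrite eq_sym -addr_eq0 addvv. Qed.

Lemma addv_eq0 x y : (x + y == 0) = (x == y).
Proof. by rewrite addr_eq0 oppv. Qed.

Lemma addv_eq x y z : (x + y == z) = (x == y + z).
Proof. by rewrite -(addv_eq0 (x + y)) -(addv_eq0 x) addrA. Qed.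

Lemma card_nz : #|[pred x : V | x != 0]| = nzcount.
Proof.
have := cardC (pred1 (0 : V)); rewrite card1 card_mx card_Fp // muln1 => E.
by rewrite /nzcount -E addKn; apply: eq_card => x; rewrite !inE.
Qed.

Lemma GL_inj g : g \in GL -> injective (mulmx g : V -> V).
Proof. by rewrite inE => ug x y /(congr1 (mulmx (invmx g))); rewrite !mulKmx. Qed.

Lemma GL_eq0 g x : g \in GL -> (g *m x == 0) = (x == 0).
Proof. by move=> gG; rewrite -(inj_eq (GL_inj gG)) mulmx0. Qed.

(** Both transposes are row free, so a pseudo-inverse gives a matrix carrying one to the other, and
    a linear map that is injective on a subspace extends to an invertible one. *)
Lemma trans_unit r (B C : 'M['F_2]_(k, r)) :
    (forall v : 'cV_r, B *m v = 0 -> v = 0) ->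
    (forall v : 'cV_r, C *m v = 0 -> v = 0) ->
  exists2 g, g \in GL & g *m B = C.
Proof.
have free D : (forall v : 'cV_r, D *m v = 0 -> v = 0) -> row_free (D^T : 'M['F_2]_(r, k)).
  move=> hD; apply/inj_row_free => v vD; apply: trmx_inj.
  by rewrite trmx0; apply: hD; apply: trmx_inj; rewrite trmx_mul !trmxK vD trmx0.
move=> /free fB /free fC.
have E : B^T *m (pinvmx B^T *m C^T) = C^T by rewrite mulmxA mulmxVp // mul1mx.
have [] := @complete_unitmx _ _ _ B^T (pinvmx B^T *m C^T).
  by rewrite E; move: fB fC; rewrite /row_free => /eqP -> /eqP ->.
move=> g ug; rewrite E => h; exists g^T; first by rewrite inE unitmx_tr.
by apply: trmx_inj; rewrite trmx_mul trmxK -h.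
Qed.

Lemma trans1 b b' : b != 0 -> b' != 0 -> exists2 g, g \in GL & g *m b = b'.
Proof.
move=> nb nb'; apply: trans_unit => v; rewrite [v]mx11_scalar mul_mx_scalar;
  case/orP: (F2E (v 0 0)) => /eqP ->; rewrite ?raddf0 // scale1r => /eqP E; exfalso.
- by rewrite E in nb.
- by rewrite E in nb'.
Qed.

Lemma row_mx1 (b : V) (v : 'cV['F_2]_1) : b *m v = v 0 0 *: b.
Proof. by rewrite [v in LHS]mx11_scalar mul_mx_scalar. Qed.

Lemma cV1_eq0 (v : 'cV['F_2]_1) : v 0 0 = 0 -> v = 0.
Proof. by move=> h; rewrite [v]mx11_scalar h raddf0. Qed.

Lemma free2 b c : b != 0 -> c != 0 -> b != c ->
  forall v : 'cV_(1 + 1), row_mx b c *m v = 0 -> v = 0.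
Proof.
move=> nb stack_nc nbc v; rewrite -[v]vsubmxK mul_row_col !row_mx1.
set u := usubmx v; set w := dsubmx v.
case/orP: (F2E (u 0 0)) => /eqP hu; case/orP: (F2E (w 0 0)) => /eqP hw;
  rewrite hu hw ?scale0r ?scale1r ?add0r ?addr0 => /eqP E.
- by rewrite (cV1_eq0 hu) (cV1_eq0 hw) col_mx0.
- by rewrite E in stack_nc.
- by rewrite E in nb.
- by rewrite addv_eq0 (negPf nbc) in E.
Qed.

(** For nonzero vectors over ['F_2] this is linear independence: a vanishing combination either
    equates two of them or says [a + b = c]. *)
Definition indep3 a b c := [&& a != b, a != c, b != c & a + b != c].

Lemma free3 a b c : a != 0 -> b != 0 -> c != 0 -> indep3 a b c ->
  forall v : 'cV_(1 + (1 + 1)), row_mx a (row_mx b c) *m v = 0 -> v = 0.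
Proof.
move=> na nb stack_nc /and4P[nab nac nbc nabc] v; rewrite -[v]vsubmxK mul_row_col row_mx1.
set u := usubmx v; set w := dsubmx v.
case/orP: (F2E (u 0 0)) => /eqP hu; rewrite hu ?scale0r ?scale1r ?add0r => E.
  by rewrite (cV1_eq0 hu) (free2 nb stack_nc nbc E) col_mx0.
move: E; rewrite -[w]vsubmxK mul_row_col !row_mx1.
case/orP: (F2E (usubmx w 0 0)) => /eqP ->; case/orP: (F2E (dsubmx w 0 0)) => /eqP ->;
  rewrite ?scale0r ?scale1r ?add0r ?addr0 => /eqP; rewrite ?addrA ?addv_eq0 => E; exfalso.
- by rewrite E in na.
- by rewrite E in nac.
- by rewrite E in nab.
- by rewrite E in nabc.
Qed.

Lemma trans2 b c c' : b != 0 -> c != 0 -> c' != 0 -> b != c -> b != c' ->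
  exists2 g, g \in GL & g *m b = b /\ g *m c = c'.
Proof.
move=> nb stack_nc nc' nbc nbc'.
have [g gG] := trans_unit (free2 nb stack_nc nbc) (free2 nb nc' nbc').
by rewrite mul_mx_row => /eq_row_mx[eb ec]; exists g.
Qed.

Lemma trans3 a b c c' : a != 0 -> b != 0 -> c != 0 -> c' != 0 ->
  indep3 a b c -> indep3 a b c' ->
  exists2 g, g \in GL & [/\ g *m a = a, g *m b = b & g *m c = c'].
Proof.
move=> na nb stack_nc nc' i1 i2.
have [g gG] := trans_unit (free3 na nb stack_nc i1) (free3 na nb nc' i2).
by rewrite !mul_mx_row => /eq_row_mx[ea /eq_row_mx[eb ec]]; exists g.
Qed.

Lemma GLM g h : g \in GL -> h \in GL -> g *m h \in GL.
Proof. by rewrite !inE unitmx_mul => -> ->. Qed.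

Lemma sum_transl (F : M -> nat) h : h \in GL ->
  (\sum_(g in GL) F (h *m g)%R = \sum_(g in GL) F g)%N.
Proof.
rewrite inE => uh; rewrite [RHS](reindex_inj (h := mulmx h)) /=; last first.
  by move=> g g' /(congr1 (mulmx (invmx h))); rewrite !mulKmx.
by apply: eq_bigl => g; rewrite !inE unitmx_mul uh.
Qed.

Definition hit1 a b := (\sum_(g in GL) (g *m a == b))%N.
Definition hit2 a b a' b' := (\sum_(g in GL) (g *m a == b) * (g *m a' == b'))%N.
Definition hit3 a b a' b' a'' b'' :=
  (\sum_(g in GL) (g *m a == b) * (g *m a' == b') * (g *m a'' == b''))%N.

Lemma sum_eq_le1 (P : pred V) x : (\sum_(y | P y) (x == y) <= 1)%N.
Proof.
have [Px|nPx] := boolP (P x).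
  by rewrite (bigD1 x) //= eqxx big1 // => y /andP[_ /negPf]; rewrite eq_sym => ->.
by rewrite big1 // => y Py; case: eqP => // E; rewrite E Py in nPx.
Qed.

Lemma sum_pick x (F : V -> nat) : x != 0 -> (\sum_(y | y != 0%R) (x == y) * F y = F x)%N.
Proof.
move=> nx; rewrite (bigD1 x) //= eqxx mul1n big1 ?addn0 // => y /andP[_ /negPf].
by rewrite eq_sym => ->.
Qed.

(* The stabiliser of the constraints already imposed is transitive on the admissible images
   [P] of the next vector, and these images partition the solution set. *)
Lemma hit_step (F : M -> bool) (P : pred V) a b :
    (forall b', P b' -> exists2 h, h \in GL & h *m b = b' /\ forall g, F (h *m g) = F g) ->
  (\sum_(g in GL) F g * (g *m a == b) * #|P| <= \sum_(g in GL) F g)%N.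
Proof.
move=> tr.
have E b' : P b' -> (\sum_(g in GL) F g * (g *m a == b'))%N = (\sum_(g in GL) F g * (g *m a == b))%N.
  case/tr => h hG [<- Fh]; rewrite -(sum_transl _ hG); apply: eq_bigr => g _.
  by rewrite Fh -mulmxA (inj_eq (GL_inj hG)).
rewrite -big_distrl /= mulnC -sum_nat_const.
rewrite -(eq_bigr _ (fun b' Pb' => E b' Pb')) exchange_big /=.
apply: leq_sum => g _; rewrite -big_distrr /= -[leqRHS]muln1 leq_mul2l sum_eq_le1.
by rewrite orbT.
Qed.

(* Bounds for [hit1], [hit2], [hit3]; when [nzcount = 3] no triple is independent and the junk value
   [x %/ 0 = 0] of [hit3_max] is the correct bound. *)
Definition hit1_max := (#|GL| %/ nzcount)%N.
Definition hit2_max := (hit1_max %/ nzcount.-1)%N.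
Definition hit3_max := (hit2_max %/ (nzcount - 3))%N.

Lemma hit1_le a b : (2 <= k)%N -> a != 0 -> b != 0 -> (hit1 a b <= hit1_max)%N.
Proof.
move=> k2 na nb; rewrite /hit1_max leq_divRL; last by rewrite /nzcount subn_gt0 -{1}(expn0 2) ltn_exp2l // ltnW.
rewrite -card_nz.
have := @hit_step (fun=> true) [pred x | x != 0] a b.
rewrite sum1_card /hit1 big_distrl /= => H.
under eq_bigr do rewrite -[nat_of_bool _]mul1n.
apply: H => b' nb'; have [h hG E] := trans1 nb nb'; by exists h.
Qed.

Lemma nz_gt1 : (2 <= k)%N -> (2 < nzcount)%N.
Proof. by move=> k2; rewrite /nzcount; have := leq_pexp2l (isT : (0 < 2)%N) k2; rewrite -[(2 ^ 2)%N]/4%N; set e := (2 ^ k)%N; lia. Qed.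

Lemma hit2_le a b a' b' : (2 <= k)%N -> b != 0 -> a != 0 -> b' != 0 -> b != b' ->
  (hit2 a b a' b' <= hit2_max)%N.
Proof.
move=> k2 nb na nb' nbb'; have nz2 := nz_gt1 k2.
rewrite /hit2_max leq_divRL; last by lia.
apply: leq_trans (hit1_le k2 na nb).
pose P := [pred x : V | (x != 0) && (x != b)].
have cP : #|P| = nzcount.-1.
  rewrite -card_nz (cardD1 b [pred x | x != 0]) inE nb /=.
  by apply: eq_card => x; rewrite !inE andbC.
rewrite -cP /hit2 big_distrl /=.
apply: (@hit_step (fun g => g *m a == b) P a' b') => c /andP[stack_nc ncb].
rewrite eq_sym in ncb; have [h hG [E1 E2]] := trans2 nb nb' stack_nc nbb' ncb.
by exists h => //; split=> // g; rewrite -mulmxA -{1}E1 (inj_eq (GL_inj hG)).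
Qed.

Lemma card_indep3 b c : b != 0 -> c != 0 -> b != c ->
  #|[pred x : V | (x != 0) && indep3 b c x]| = (nzcount - 3)%N.
Proof.
move=> nb stack_nc nbc.
have := cardID (mem [:: b; c; b + c]) [pred x | x != 0]; rewrite card_nz.
  have -> : #|[predI [pred x | x != 0] & mem [:: b; c; b + c]]| = 3%N.
    have /card_uniqP : uniq [:: b; c; b + c].
      rewrite /= !inE negb_or nbc /= !andbT; apply/andP; split.
        by rewrite eq_sym addrC addv_eq addvv.
      by rewrite eq_sym addv_eq addvv.
    move=> /= <-; apply: eq_card => x; rewrite !inE andbC; case: eqP => [->//|_].
    case: eqP => [->//|_]; case: eqP => [->|//]; by rewrite addv_eq0 nbc.
  move=> <-; rewrite addKn; apply: eq_card => x; rewrite !inE /indep3 nbc /=.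
  rewrite (eq_sym x b) (eq_sym x c) (eq_sym x) !negb_or andbC.
  by rewrite -!andbA.
Qed.

Lemma hit3_le a b a' b' a'' b'' : (2 <= k)%N -> a != 0 ->
    b != 0 -> b' != 0 -> b'' != 0 -> indep3 b b' b'' ->
  (hit3 a b a' b' a'' b'' <= hit3_max)%N.
Proof.
move=> k2 na nb nb' nb'' ib; have nz2 := nz_gt1 k2.
have nbb' : b != b' by case/and4P: ib.
pose P := [pred x : V | (x != 0) && indep3 b b' x].
have cP : #|P| = (nzcount - 3)%N by apply: card_indep3.
have P0 : P b'' by rewrite inE nb''.
have nz3 : (0 < nzcount - 3)%N by rewrite -cP; apply/card_gt0P; exists b''.
rewrite /hit3_max leq_divRL //; apply: leq_trans (hit2_le a' k2 nb na nb' nbb').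
rewrite -cP /hit3 big_distrl /=.
rewrite /hit2; under eq_bigr do rewrite mulnb.
under [leqRHS]eq_bigr do rewrite mulnb.
apply: (@hit_step (fun g => (g *m a == b) && (g *m a' == b')) P a'' b'').
move=> c /andP[stack_nc ic].
have [h hG [E1 E2 E3]] := trans3 nb nb' nb'' stack_nc ib ic.
by exists h => //; split=> // g; rewrite -!mulmxA -{1}E1 -{1}E2 !(inj_eq (GL_inj hG)).
Qed.

(** The six summands are the possible relation patterns of three nonzero vectors: all equal, one of
    three pairs equal, a plane with [a + a' = a''], independent. An invertible [g] preserves the
    pattern, so sources and targets must share it, and the bound depends only on the dimension of
    their span. *)
Lemma hit3_bound a b a' b' a'' b'' : (2 <= k)%N -> a != 0 -> a' != 0 -> a'' != 0 ->
    b != 0 -> b' != 0 -> b'' != 0 ->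
  (hit3 a b a' b' a'' b'' <=
    hit1_max * [&& a == a', a == a'', b == b' & b == b'']
  + hit2_max * [&& a == a', a != a'', b == b' & b != b'']
  + hit2_max * [&& a == a'', a != a', b == b'' & b != b']
  + hit2_max * [&& a' == a'', a != a', b' == b'' & b != b']
  + hit2_max * [&& a != a', (a + a')%R == a'', b != b' & (b + b')%R == b'']
  + hit3_max * (indep3 a a' a'' && indep3 b b' b''))%N.
Proof.
move=> k2 na na' na'' nb nb' nb''.
have [/eqP ->|h0] := boolP (hit3 a b a' b' a'' b'' == 0%N); first by [].
have : exists2 g, g \in GL & [&& g *m a == b, g *m a' == b' & g *m a'' == b''].
  apply/exists_inP; apply: contraR h0; rewrite negb_exists_in => /forall_inP H.
  apply/eqP; apply: big1 => g /H; rewrite !negb_and.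
  by do 3![case: eqP].
case=> g gG /and3P[/eqP e /eqP e' /eqP e''].
have E1 : (b == b') = (a == a') by rewrite -e -e' (inj_eq (GL_inj gG)).
have E2 : (b == b'') = (a == a'') by rewrite -e -e'' (inj_eq (GL_inj gG)).
have E3 : (b' == b'') = (a' == a'') by rewrite -e' -e'' (inj_eq (GL_inj gG)).
have E4 : (b + b' == b'') = (a + a' == a'').
  by rewrite -e' -e'' -e -mulmxDr (inj_eq (GL_inj gG)).
have I : indep3 b b' b'' = indep3 a a' a'' by rewrite /indep3 E1 E2 E3 E4.
have le1 : (hit3 a b a' b' a'' b'' <= hit1 a b)%N.
  by apply: leq_sum => h _; case: eqP; case: eqP; case: eqP.
have le12 : (hit3 a b a' b' a'' b'' <= hit2 a b a' b')%N.
  by apply: leq_sum => h _; case: eqP; case: eqP; case: eqP.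
have le13 : (hit3 a b a' b' a'' b'' <= hit2 a b a'' b'')%N.
  by apply: leq_sum => h _; case: eqP; case: eqP; case: eqP.
rewrite I andbb E1 E2 E3 E4.
have l1 : (hit3 a b a' b' a'' b'' <= hit1_max)%N := leq_trans le1 (hit1_le k2 na nb).
have l2 : (a == a') || (hit3 a b a' b' a'' b'' <= hit2_max)%N.
  have [//|naa'] := boolP (a == a').
  by apply: leq_trans le12 _; apply: hit2_le => //; rewrite E1.
have l3 : (a == a'') || (hit3 a b a' b' a'' b'' <= hit2_max)%N.
  have [//|naa''] := boolP (a == a'').
  by apply: leq_trans le13 _; apply: hit2_le => //; rewrite E2.
have l4 : indep3 a a' a'' ==> (hit3 a b a' b' a'' b'' <= hit3_max)%N.
  by apply/implyP => ia; apply: hit3_le => //; rewrite I.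
move: l1 l2 l3 l4; rewrite /indep3; move: (hit3 _ _ _ _ _ _) hit1_max hit2_max hit3_max => h t1 t2 t3.
case: (a == a'); case: (a == a''); case: (a' == a''); case: (a + a' == a'') => /=;
  rewrite ?muln0 ?muln1 ?addn0 ?add0n //; clear; lia.
Qed.

End GLcount.

(** * * Fixed vectors when one generator is resampled *)

Section Fix.
Variable k : nat.
Hypothesis k2 : (2 <= k)%N.
Local Notation V := 'cV['F_2]_k.
Local Notation M := 'M['F_2]_k.
Local Notation n := (nzcount k).
Local Notation GL := (GL k).
Implicit Types (a b x y z : V) (g h u v w : M) (F G H : V -> V -> V -> nat).

Definition fixpts (g : M) := (\sum_(x : V | x != 0%R) (g *m x == x))%N.

Lemma leq_nat_of_bool (b c : bool) : (b -> c) -> (b <= c)%N.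
Proof. by case: b; case: c => // /(_ isT). Qed.

Lemma sum_const_nz c : (\sum_(x : V | x != 0%R) c = n * c)%N.
Proof. by rewrite sum_nat_const card_nz. Qed.

Lemma sum_le_nz (f : V -> nat) c : (forall x, x != 0 -> (f x <= c)%N) ->
  (\sum_(x : V | x != 0%R) f x <= n * c)%N.
Proof. by move=> h; rewrite -sum_const_nz; apply: leq_sum. Qed.

Lemma sum_le_f (f h : V -> nat) c : (forall x, x != 0 -> (f x <= h x * c)%N) ->
  (\sum_(x : V | x != 0%R) f x <= (\sum_(x : V | x != 0%R) h x) * c)%N.
Proof. by move=> H; rewrite big_distrl; apply: leq_sum. Qed.

Lemma fixpts_le g : (fixpts g <= n)%N.
Proof. by rewrite -[leqRHS]muln1; apply: sum_le_nz => x _; case: eqP. Qed.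

Lemma fixpts_compl g : (\sum_(x : V | x != 0%R) (g *m x != x) = n - fixpts g)%N.
Proof.
apply/eqP; rewrite -(eqn_add2l (fixpts g)) subnKC ?fixpts_le // -big_split /=.
rewrite -[eqbRHS]muln1 -sum_const_nz; apply/eqP; apply: eq_bigr => x _.
by case: eqP.
Qed.

Lemma sum_eql u z : u \in GL -> (\sum_(x : V | x != 0%R) (u *m x == z) <= 1)%N.
Proof.
move=> uG; rewrite (reindex_inj (h := mulmx (invmx u))) /=; last first.
  have uiG : invmx u \in GL by rewrite inE unitmx_inv; rewrite inE in uG.
  exact: GL_inj uiG.
apply: leq_trans (sum_eq_le1 (fun x => invmx u *m x != 0) z).
apply: leq_sum => x _; rewrite mulKVmx; last by rewrite inE in uG.
by rewrite eq_sym.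
Qed.

Lemma sum_neq z : z != 0 -> (\sum_(x : V | x != 0%R) (x != z) = n.-1)%N.
Proof.
move=> nz0; rewrite (bigD1 z) //= eqxx add0n.
rewrite (eq_bigr (fun=> 1%N)) => [|x /andP[_ ->] //].
rewrite sum1_card -(card_nz k) (cardD1 z [pred x | x != 0]) inE nz0 /=.
by apply: eq_card => x; rewrite !inE andbC.
Qed.

Lemma sum_neql u z : u \in GL -> z != 0 ->
  (\sum_(x : V | x != 0%R) (z != u *m x) <= n.-1)%N.
Proof.
move=> uG z0; have uu : u \in unitmx by rewrite inE in uG.
have uiG : invmx u \in GL by rewrite inE unitmx_inv.
have z'0 : invmx u *m z != 0 by rewrite GL_eq0.
rewrite -(sum_neq z'0); apply: leq_sum => x _; apply: leq_nat_of_bool; apply: contraNneq => ->.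
by rewrite mulKVmx.
Qed.

Lemma sum_indep a b : a != 0 -> b != 0 ->
  (\sum_(x : V | x != 0%R) indep3 x a b <= n - 3)%N.
Proof.
move=> na nb; have [<-|nab] := eqVneq a b.
  by rewrite big1 // => x _; rewrite /indep3 eqxx !andbF.
rewrite -(card_indep3 na nb nab) -sum1_card big_mkcondr /=.
apply: leq_sum => x _; rewrite /indep3 (eq_sym x a) (eq_sym x b) nab (addv_eq x).
by rewrite (eq_sym x (a + b)); do 4?[case: eqP].
Qed.

Lemma hit1_max_le : (n * hit1_max k <= #|GL|)%N.
Proof. by rewrite mulnC leq_divM. Qed.
Lemma hit2_max_le : (n.-1 * hit2_max k <= hit1_max k)%N.
Proof. by rewrite mulnC leq_divM. Qed.
Lemma hit3_max_le : ((n - 3) * hit3_max k <= hit2_max k)%N.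
Proof. by rewrite mulnC leq_divM. Qed.

Lemma fixpts_resample1 u : u \in GL -> (\sum_(g in GL) fixpts (g *m u) <= #|GL|)%N.
Proof.
move=> uG; rewrite exchange_big /=; apply: leq_trans hit1_max_le.
apply: sum_le_nz => x x0; under eq_bigr do rewrite -mulmxA.
by apply: hit1_le => //; rewrite GL_eq0.
Qed.

(** Introduce [y = g *m v *m x]; then [g] must send [v *m x] to [y] and [u *m y] to [x]. The case
    [y = x] contributes at most [n * hit1_max], and the [n - 1] other values give two distinct
    images and contribute at most [n * (n - 1) * hit2_max]. Each part is at most [#|GL|]. *)
Lemma fixpts_resample_same u v : u \in GL -> v \in GL ->
  (\sum_(g in GL) fixpts (g *m u *m g *m v) <= 2 * #|GL|)%N.
Proof.
move=> uG vG; rewrite exchange_big /=.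
have n3 := nz_gt1 k2.
have t1 := hit1_max_le; have t2 := hit2_max_le.
suff : (\sum_(x : V | x != 0%R) \sum_(g in GL) (g *m u *m g *m v *m x == x)
   <= n * (hit1_max k + n.-1 * hit2_max k))%N.
  move=> h; apply: leq_trans h _; apply: (@leq_trans (n * (hit1_max k + hit1_max k))).
    by rewrite leq_mul2l leq_add2l t2 orbT.
  by rewrite mulnDr mul2n -addnn leq_add.
apply: sum_le_nz => x x0.
under eq_bigr => g gG.
  rewrite -!mulmxA.
  rewrite -(sum_pick (x := g *m (v *m x)) (fun y => nat_of_bool (g *m (u *m y) == x))); last first.
    by rewrite !GL_eq0.
  over.
rewrite exchange_big (bigD1 x) //=; apply: leq_add.
  apply: leq_trans (hit1_le (a := v *m x) (b := x) k2 _ _) => //; last by rewrite GL_eq0.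
  by apply: leq_sum => g _; case: eqP; case: eqP.
rewrite (eq_bigl (fun y => (y \in [pred y | (y != 0) && (y != x)]))); last by [].
have -> : n.-1 = #|[pred y : V | (y != 0) && (y != x)]|.
  rewrite -(card_nz k) (cardD1 x [pred x | x != 0]) inE x0 /=.
  by apply: eq_card => y; rewrite !inE andbC.
rewrite -sum_nat_const; apply: leq_sum => y /andP[y0 yx].
by apply: hit2_le => //; rewrite GL_eq0.
Qed.

(* Exact in [fixpts v], since the crossing letter averages [fixpts v] to 1. *)
Lemma fixpts_resample_opp u v : u \in GL -> v \in GL ->
  (n.-1 * \sum_(g in GL) fixpts (g *m u *m invmx g *m v)
     <= #|GL| * (n.-1 * fixpts v + (n - fixpts v)))%N.
Proof.
move=> uG vG; rewrite exchange_big /=.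
have t1 := hit1_max_le; have t2 := hit2_max_le.
suff : (\sum_(x : V | x != 0%R) \sum_(g in GL) (g *m u *m invmx g *m v *m x == x)
   <= \sum_(x : V | x != 0%R) (n * hit1_max k * (v *m x == x) + n * hit2_max k * (v *m x != x)))%N.
  rewrite big_split /= -!big_distrr /= -/(fixpts v) fixpts_compl => h.
  apply: leq_trans (leq_mul (leqnn _) h) _.
  move: (fixpts v) (n - fixpts v)%N => f f'.
  apply: (@leq_trans (n * hit1_max k * (n.-1 * f + f'))); last by rewrite leq_mul2r t1 orbT.
  rewrite !mulnDr leq_add //; first by rewrite mulnCA.
  by rewrite mulnA leq_mul2r mulnCA leq_mul2l t2 !orbT.
apply: leq_sum => x x0.
under eq_bigr => g gG.
  rewrite -!mulmxA.
  rewrite -(sum_pick (x := invmx g *m (v *m x)) (fun y => nat_of_bool (g *m (u *m y) == x))); last first.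
    by rewrite !GL_eq0 // inE unitmx_inv; rewrite inE in gG.
  over.
rewrite exchange_big /= -!mulnA -mulnDr.
apply: sum_le_nz => y y0.
have -> : (\sum_(g in GL) (invmx g *m (v *m x) == y) * (g *m (u *m y) == x)
   = hit2 y (v *m x) (u *m y) x)%N.
  apply: eq_bigr => g gG; congr (_ * _)%N; rewrite -(inj_eq (GL_inj gG)) mulKVmx 1?eq_sym //.
  by rewrite inE in gG.
(* The two images are [v *m x] and [x]; they coincide exactly when [v] fixes [x], which is how
   [fixpts v] enters. *)
have [e|e] := eqVneq (v *m x) x; rewrite /= ?muln1 ?muln0 ?addn0 ?add0n.
  apply: leq_trans (hit1_le (a := u *m y) (b := x) k2 _ _) => //; last by rewrite GL_eq0.
  by apply: leq_sum => g _; case: eqP; case: eqP.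
by apply: hit2_le => //; rewrite GL_eq0.
Qed.

Definition sum3 F := (\sum_(x : V | x != 0%R) \sum_(y : V | y != 0%R)
  \sum_(z : V | z != 0%R) F x y z)%N.

Lemma leq_sum3 F G : (forall x y z, x != 0 -> y != 0 -> z != 0 -> (F x y z <= G x y z)%N) ->
  (sum3 F <= sum3 G)%N.
Proof.
by move=> h; apply: leq_sum => x x0; apply: leq_sum => y y0; apply: leq_sum => z z0; apply: h.
Qed.

Lemma sum3D F G : sum3 (fun x y z => F x y z + G x y z)%N = (sum3 F + sum3 G)%N.
Proof.
rewrite /sum3 -big_split; apply: eq_bigr => x _; rewrite -big_split; apply: eq_bigr => y _.
exact: big_split.
Qed.

Lemma sum3Z c F : sum3 (fun x y z => c * F x y z)%N = (c * sum3 F)%N.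
Proof.
rewrite /sum3 big_distrr; apply: eq_bigr => x _; rewrite big_distrr; apply: eq_bigr => y _.
by rewrite big_distrr.
Qed.

Lemma sum3_rot F : sum3 F = sum3 (fun z x y => F x y z).
Proof.
rewrite /sum3 [RHS]exchange_big; apply: eq_bigr => x _.
by rewrite exchange_big.
Qed.

Lemma sum3_swap F : sum3 F = sum3 (fun x z y => F x y z).
Proof. by apply: eq_bigr => x _; rewrite exchange_big. Qed.

(* The three factors bound the choices of [x], of [y] given [x], and of [z] given [x] and [y]. *)
Lemma sum3_le F (f : V -> nat) (g : V -> V -> nat) (h : V -> V -> V -> nat) A B C :
    (forall x y z, x != 0 -> y != 0 -> z != 0 -> (F x y z <= f x * g x y * h x y z)%N) ->
    (\sum_(x : V | x != 0%R) f x <= A)%N ->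
    (forall x, x != 0 -> f x != 0%N -> (\sum_(y : V | y != 0%R) g x y <= B)%N) ->
    (forall x y, x != 0 -> y != 0 -> f x != 0%N -> g x y != 0%N ->
       (\sum_(z : V | z != 0%R) h x y z <= C)%N) ->
  (sum3 F <= A * (B * C))%N.
Proof.
move=> hF hA hB hC; apply: leq_trans (leq_mul hA (leqnn _)).
apply: sum_le_f => x x0; have [fx0|fx0] := eqVneq (f x) 0%N.
  by rewrite big1 // => y y0; rewrite big1 // => z z0; apply/eqP; rewrite -leqn0;
    apply: leq_trans (hF _ _ _ _ _ _) _; rewrite ?fx0.
apply: leq_trans (_ : f x * ((\sum_(y : V | y != 0%R) g x y) * C) <= _)%N; last first.
  by rewrite leq_mul2l leq_mul2r hB ?orbT.
rewrite big_distrl big_distrr; apply: leq_sum => y y0 /=.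
have [gx0|gx0] := eqVneq (g x y) 0%N.
  by rewrite big1 // => z z0; apply/eqP; rewrite -leqn0;
    apply: leq_trans (hF _ _ _ _ _ _) _; rewrite ?gx0 ?muln0.
apply: leq_trans (_ : f x * g x y * (\sum_(z : V | z != 0%R) h x y z) <= _)%N; last first.
  by rewrite -mulnA !leq_mul2l hC ?orbT.
by rewrite big_distrr; apply: leq_sum => z z0; apply: hF.
Qed.

Lemma sum_const1 : (\sum_(x : V | x != 0%R) 1 <= n)%N.
Proof. by rewrite sum_const_nz muln1. Qed.

(** The summands are the patterns of [hit3_bound], weighted by bounds on their numbers of triples,
    with [a] for [fixpts v]. The two terms in [n * n.-1] cost one [#|GL|] each. With [r = n - a],
    the other four are at most [hit1_max * (2 * a + 2 * r + n)], that is [3 * n * hit1_max]. Hence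
    5. *)
Lemma hits_mpp_le (a : nat) : (a <= n)%N ->
  (hit1_max k * a + hit2_max k * n + hit2_max k * (a * n.-1) + hit2_max k * (n * n.-1) + hit2_max k * (n * n.-1)
     + hit3_max k * ((n - a) * (n * (n - 3))) <= 5 * #|GL|)%N.
Proof.
move=> an; have := nz_gt1 k2; have := hit1_max_le; have := hit2_max_le; have := hit3_max_le.
move: (hit1_max k) (hit2_max k) (hit3_max k) n an #|GL| => t1 t2 t3 [|[|[|j]]] // an G.
rewrite /= (_ : j.+3 - 3 = j)%N; last by lia.
move=> h3 h2 h1 _; set r := (j.+3 - a)%N.
have aE : (a = j.+3 - r)%N by rewrite /r; lia.
have k3 : (t3 * (r * (j.+3 * j)) <= r * (j.+3 * t2))%N.
  by rewrite mulnC -!mulnA !leq_mul2l h3 !orbT.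
have k2' : (j.+2 * t2 * (2 * r + j.+3) <= t1 * (2 * r + j.+3))%N by rewrite leq_mul2r h2 orbT.
have k4 : (t2 * (a * j.+2) <= t1 * a)%N by rewrite mulnCA mulnC leq_mul2r mulnC h2 orbT.
have k5 : (t2 * (j.+3 * j.+2) <= t1 * j.+3)%N by rewrite mulnCA mulnC leq_mul2r mulnC h2 orbT.
have k6 : (t2 * j.+3 + r * (j.+3 * t2) <= j.+2 * t2 * (2 * r + j.+3))%N by nia.
have k7 : (t1 * a + t1 * a + t1 * (2 * r + j.+3) = 3 * (t1 * j.+3))%N.
  by rewrite -!mulnDr mulnCA; congr (_ * _)%N; lia.
have : (j.+3 * t1 = t1 * j.+3)%N by rewrite mulnC.
lia.
Qed.

(** The first term and the last two cost at most [#|GL|] each and the other three at most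
    [#|GL| / (n - 1)] each, so 5 leaves room because [n >= 3]. *)
Lemma hits_ppp_le :
  (hit1_max k * n + hit2_max k * n + hit2_max k * n + hit2_max k * n + hit2_max k * (n * n.-1)
     + hit3_max k * (n * (n.-1 * (n - 3))) <= 5 * #|GL|)%N.
Proof.
have := nz_gt1 k2; have := hit1_max_le; have := hit2_max_le; have := hit3_max_le.
move: (hit1_max k) (hit2_max k) (hit3_max k) n #|GL| => t1 t2 t3 [|[|[|j]]] // G.
rewrite /= (_ : j.+3 - 3 = j)%N; last by lia.
move=> h3 h2 h1 _.
have h4 : (t3 * (j.+3 * (j.+2 * j)) <= j.+3 * (j.+2 * t2))%N.
  by rewrite mulnC -!mulnA !leq_mul2l h3 !orbT.
have h5 : (j.+3 * (j.+2 * t2) <= j.+3 * t1)%N by rewrite leq_mul2l h2 orbT.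
nia.
Qed.

(** With [y = g *m w *m x] and [z = g *m v *m y], a fixed vector [x] amounts to three prescribed
    images under [g]. Since [u], [v], [w] are invertible, each relation in a pattern determines one
    of [x], [y], [z] from the others, which bounds the number of triples. *)
Lemma fixpts_resample_ppp u v w : u \in GL -> v \in GL -> w \in GL ->
  (\sum_(g in GL) fixpts (g *m u *m g *m v *m g *m w) <= 5 * #|GL|)%N.
Proof.
move=> uG vG wG.
have -> : (\sum_(g in GL) fixpts (g *m u *m g *m v *m g *m w) =
    sum3 (fun x y z => hit3 (w *m x) y (v *m y) z (u *m z) x))%N.
  rewrite exchange_big; apply: eq_bigr => x x0.
  rewrite -[RHS](eq_bigr _ (fun y _ => exchange_big _ _ _ _ _ _)) /=.
  rewrite [RHS]exchange_big; apply: eq_bigr => g gG /=; rewrite -!mulmxA.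
  rewrite -(sum_pick (x := g *m (w *m x)) (fun y => nat_of_bool (g *m (u *m (g *m (v *m y))) == x))); last first.
    by rewrite !GL_eq0.
  apply: eq_bigr => y y0.
  rewrite -(sum_pick (x := g *m (v *m y)) (fun y => nat_of_bool (g *m (u *m y) == x))); last first.
    by rewrite !GL_eq0.
  by rewrite big_distrr; apply: eq_bigr => z z0 /=; rewrite mulnA.
apply: leq_trans hits_ppp_le.
apply: leq_trans (leq_sum3 _) _.
  move=> x y z x0 y0 z0; apply: hit3_bound => //; by rewrite GL_eq0.
rewrite !sum3D !sum3Z; do ![apply: leq_add]; rewrite leq_mul2l; apply/orP; right.
- rewrite -[leqRHS]muln1 -[X in (_ <= _ * X)%N]muln1.
  apply: (@sum3_le _ (fun=> 1%N) (fun x y => nat_of_bool (x == y)) (fun x y z => nat_of_bool (y == z))).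
  + move=> x y z _ _ _; rewrite mul1n mulnb; apply: leq_nat_of_bool.
    by case/and4P => _ _ /eqP -> /eqP ->; rewrite eqxx.
  + exact: sum_const1.
  + by move=> x _ _; apply: sum_eq_le1.
  + by move=> x y _ _ _ _; apply: sum_eq_le1.
- rewrite -[leqRHS]muln1 -[X in (_ <= _ * X)%N]muln1 sum3_rot.
  apply: (@sum3_le _ (fun=> 1%N) (fun z x => nat_of_bool (w *m x == v *m z)) (fun z x y => nat_of_bool (z == y))).
  + move=> z x y _ _ _; rewrite mul1n mulnb; apply: leq_nat_of_bool.
    by case/and4P => /eqP -> _ /eqP -> _; rewrite !eqxx.
  + exact: sum_const1.
  + by move=> x _ _; apply: sum_eql.
  + by move=> x y _ _ _ _; apply: sum_eq_le1.
- rewrite -[leqRHS]muln1 -[X in (_ <= _ * X)%N]muln1 sum3_rot.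
  apply: (@sum3_le _ (fun=> 1%N) (fun z x => nat_of_bool (w *m x == u *m z)) (fun z x y => nat_of_bool (x == y))).
  + move=> z x y _ _ _; rewrite mul1n mulnb; apply: leq_nat_of_bool.
    by case/and4P => /eqP -> _ /eqP -> _; rewrite !eqxx.
  + exact: sum_const1.
  + by move=> x _ _; apply: sum_eql.
  + by move=> x y _ _ _ _; apply: sum_eq_le1.
- rewrite -[leqRHS]muln1 -[X in (_ <= _ * X)%N]muln1 sum3_rot.
  apply: (@sum3_le _ (fun=> 1%N) (fun z x => nat_of_bool (z == x)) (fun z x y => nat_of_bool (v *m y == u *m z))).
  + move=> z x y _ _ _; rewrite mul1n mulnb; apply: leq_nat_of_bool.
    by case/and4P => /eqP -> _ /eqP -> _; rewrite !eqxx.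
  + exact: sum_const1.
  + by move=> x _ _; apply: sum_eq_le1.
  + by move=> x y _ _ _ _; apply: sum_eql.
- rewrite -[n.-1]muln1 sum3_rot sum3_rot.
  apply: (@sum3_le _ (fun=> 1%N) (fun y z => nat_of_bool (z != y)) (fun y z x => nat_of_bool (y + z == x))).
  + move=> y z x _ _ _; rewrite mul1n mulnb; apply: leq_nat_of_bool.
    by case/and4P => _ _ ne ->; rewrite eq_sym ne.
  + exact: sum_const1.
  + by move=> y y0 _; rewrite sum_neq.
  + by move=> x y _ _ _ _; apply: sum_eq_le1.
rewrite sum3_rot sum3_rot.
apply: (@sum3_le _ (fun=> 1%N) (fun y z => nat_of_bool (z != y)) (fun y z x => nat_of_bool (indep3 x y z))).
+ move=> y z x _ _ _; rewrite mul1n mulnb; apply: leq_nat_of_bool => /andP[_].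
  rewrite /indep3 (eq_sym x y) (eq_sym x z) => /and4P[e1 e2 e3 e4].
  by rewrite eq_sym e1 e2 e3 /= addv_eq eq_sym e4.
+ exact: sum_const1.
+ by move=> y y0 _; rewrite sum_neq.
+ by move=> y z y0 z0 _ _; apply: sum_indep.
Qed.

(** Moving [invmx g] across, the third condition is that [g] sends [x] to [w *m z]. Two of the
    sources are now [v *m x] and [x], so equality between them restricts [x] to the vectors fixed by
    [v]. *)
Lemma fixpts_resample_mpp u v w : u \in GL -> v \in GL -> w \in GL ->
  (\sum_(g in GL) fixpts (invmx g *m w *m g *m u *m g *m v) <= 5 * #|GL|)%N.
Proof.
move=> uG vG wG.
have -> : (\sum_(g in GL) fixpts (invmx g *m w *m g *m u *m g *m v) =
    sum3 (fun x y z => hit3 (v *m x) y (u *m y) z x (w *m z)))%N.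
  rewrite exchange_big; apply: eq_bigr => x x0.
  rewrite -[RHS](eq_bigr _ (fun y _ => exchange_big _ _ _ _ _ _)) /=.
  rewrite [RHS]exchange_big; apply: eq_bigr => g gG /=; rewrite -!mulmxA.
  rewrite -(sum_pick (x := g *m (v *m x)) (fun y => nat_of_bool (invmx g *m (w *m (g *m (u *m y))) == x))); last first.
    by rewrite !GL_eq0.
  apply: eq_bigr => y y0.
  rewrite -(sum_pick (x := g *m (u *m y)) (fun y => nat_of_bool (invmx g *m (w *m y) == x))); last first.
    by rewrite !GL_eq0.
  rewrite big_distrr; apply: eq_bigr => z z0 /=; rewrite mulnA; congr (_ * _)%N.
  by rewrite -(inj_eq (GL_inj gG)) mulKVmx 1?eq_sym //; rewrite inE in gG.
apply: leq_trans (hits_mpp_le (fixpts_le v)).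
apply: leq_trans (leq_sum3 _) _.
  move=> x y z x0 y0 z0; apply: hit3_bound => //; by rewrite GL_eq0.
rewrite !sum3D !sum3Z; do ![apply: leq_add]; rewrite leq_mul2l; apply/orP; right.
- rewrite -[leqRHS]muln1 -[X in (_ <= _ * X)%N]muln1.
  apply: (@sum3_le _ (fun x => nat_of_bool (v *m x == x)) (fun x y => nat_of_bool (x == u *m y))
           (fun x y z => nat_of_bool (y == z))).
  + move=> x y z _ _ _; rewrite !mulnb; apply: leq_nat_of_bool.
    by case/and4P => /eqP e /eqP e' /eqP <- _; rewrite -e e' !eqxx.
  + by [].
  + by move=> x _ _; under eq_bigr do rewrite eq_sym; apply: sum_eql.
  + by move=> x y _ _ _ _; apply: sum_eq_le1.
- rewrite -[leqRHS]muln1 -[X in (_ <= _ * X)%N]muln1.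
  apply: (@sum3_le _ (fun=> 1%N) (fun x y => nat_of_bool (u *m y == v *m x)) (fun x y z => nat_of_bool (y == z))).
  + move=> z x y _ _ _; rewrite mul1n mulnb; apply: leq_nat_of_bool.
    by case/and4P => /eqP -> _ /eqP -> _; rewrite !eqxx.
  + exact: sum_const1.
  + by move=> x _ _; apply: sum_eql.
  + by move=> x y _ _ _ _; apply: sum_eq_le1.
- rewrite -[n.-1]muln1.
  apply: (@sum3_le _ (fun x => nat_of_bool (v *m x == x)) (fun x y => nat_of_bool (v *m x != u *m y))
           (fun x y z => nat_of_bool (w *m z == y))).
  + move=> x y z _ _ _; rewrite !mulnb; apply: leq_nat_of_bool.
    by case/and4P => -> -> /eqP -> _; rewrite eqxx.
  + by [].
  + by move=> x x0 _; apply: sum_neql => //; rewrite GL_eq0.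
  + by move=> x y _ _ _ _; apply: sum_eql.
- rewrite -[n.-1]mul1n.
  apply: (@sum3_le _ (fun=> 1%N) (fun x y => nat_of_bool (u *m y == x)) (fun x y z => nat_of_bool (z != y))).
  + move=> x y z _ _ _; rewrite !mul1n mulnb; apply: leq_nat_of_bool.
    by case/and4P => -> _ _ ne; rewrite eq_sym ne.
  + exact: sum_const1.
  + by move=> x _ _; apply: sum_eql.
  + by move=> x y x0 y0 _ _; rewrite sum_neq.
(* The targets satisfy [y + z = w *m z], so [z] determines [y]. *)
- rewrite -[n.-1]mul1n sum3_rot sum3_swap.
  apply: (@sum3_le _ (fun=> 1%N) (fun z y => nat_of_bool (z + w *m z == y)) (fun z y x => nat_of_bool (v *m x != u *m y))).
  + move=> z y x _ _ _; rewrite !mul1n mulnb; apply: leq_nat_of_bool.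
    by case/and4P => -> _ _ h; rewrite andbT addv_eq (addrC (w *m z)) -addv_eq addrC.
  + exact: sum_const1.
  + by move=> z _ _; apply: sum_eq_le1.
  + move=> z y z0 y0 _ _; under eq_bigr do rewrite eq_sym.
    by apply: sum_neql => //; rewrite GL_eq0.
(* Independent pattern: [x] is not fixed by [v], [z] is free, and [y] avoids the span of [z] and
   [w *m z]. *)
rewrite sum3_swap.
apply: (@sum3_le _ (fun x => nat_of_bool (v *m x != x)) (fun x z => 1%N) (fun x z y => nat_of_bool (indep3 y z (w *m z)))).
+ move=> x z y _ _ _; rewrite muln1 mulnb; apply: leq_nat_of_bool.
  by case/andP => /and4P[_ -> _ _] ->.
+ by rewrite fixpts_compl.
+ by move=> x _ _; apply: sum_const1.
+ by move=> x z x0 z0 _ _; apply: sum_indep; rewrite // GL_eq0.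
Qed.

End Fix.

(** * Fixed vectors of random words *)

Section Words.
Variables (k d : nat).
Hypothesis k2 : (2 <= k)%N.
Local Notation V := 'cV['F_2]_k.
Local Notation M := 'M['F_2]_k.
Local Notation n := (nzcount k).
Local Notation GL := (GL k).
Local Notation L := 'I_d.
Local Notation GLt := (GLtuples k d).
Implicit Types (g u v w : M) (s : {ffun L -> M}) (i j : L) (sw : seq (L * bool)) (b : bool).

Definition signed g b := if b then g else invmx g.
Fixpoint word_mx s sw : M :=
  if sw is (j, b) :: sw' then word_mx s sw' *m signed (s j) b else 1%:M.

Lemma word_mx_cat s sw1 sw2 : word_mx s (sw1 ++ sw2) = word_mx s sw2 *m word_mx s sw1.
Proof. by elim: sw1 => [|[j b] sw1 IH] /=; rewrite ?mulmx1 // IH mulmxA. Qed.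

Lemma GL1 : 1%:M \in GL.
Proof. by rewrite inE unitmx1. Qed.

Lemma GLV g : g \in GL -> invmx g \in GL.
Proof. by rewrite !inE unitmx_inv. Qed.

Lemma signed_GL g b : g \in GL -> signed g b \in GL.
Proof. by case: b => //; apply: GLV. Qed.

Lemma GLtP s : reflect (forall j, s j \in GL) (s \in GLt).
Proof.
rewrite inE; apply: (iffP forallP) => h j; first by rewrite inE h.
by have := h j; rewrite inE.
Qed.

Lemma word_mx_GL s sw : s \in GLt -> word_mx s sw \in GL.
Proof.
move=> /GLtP sG; elim: sw => [|[j b] sw IH] /=; first exact: GL1.
by apply: GLM => //; apply: signed_GL.
Qed.

(** [g] carries the vectors fixed by [h *m g] onto those fixed by [g *m h]. *)
Lemma fixptsC g h : g \in GL -> h \in GL -> fixpts (g *m h) = fixpts (h *m g).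
Proof.
move=> gG hG; rewrite /fixpts [LHS](reindex_inj (GL_inj gG)).
apply: eq_big => [x|x _]; first by rewrite GL_eq0.
by rewrite -mulmxA (inj_eq (GL_inj gG)) mulmxA.
Qed.

Lemma fixpts_rot2 q g1 u g2 p : q \in GL -> g1 \in GL -> u \in GL -> g2 \in GL -> p \in GL ->
  fixpts (q *m g1 *m u *m g2 *m p) = fixpts (g1 *m u *m g2 *m (p *m q)).
Proof.
move=> h1 h2 h3 h4 h5; have h : g1 *m (u *m (g2 *m p)) \in GL by exact: (GLM h2 (GLM h3 (GLM h4 h5))).
by rewrite -!mulmxA; apply: (etrans (fixptsC h1 h)); rewrite -!mulmxA.
Qed.

Lemma fixpts_rot3 q g1 u g2 v g3 p : q \in GL -> g1 \in GL -> u \in GL -> g2 \in GL ->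
    v \in GL -> g3 \in GL -> p \in GL ->
  fixpts (q *m g1 *m u *m g2 *m v *m g3 *m p) = fixpts (g1 *m u *m g2 *m v *m g3 *m (p *m q)).
Proof.
move=> h1 h2 h3 h4 h5 h6 h7; have h : g1 *m (u *m (g2 *m (v *m (g3 *m p)))) \in GL.
  exact: (GLM h2 (GLM h3 (GLM h4 (GLM h5 (GLM h6 h7))))).
by rewrite -!mulmxA; apply: (etrans (fixptsC h1 h)); rewrite -!mulmxA.
Qed.

Definition resample s j g : {ffun L -> M} := [ffun i => if i == j then g else s i].

Lemma resample_eq s j g : resample s j g j = g. Proof. by rewrite ffunE eqxx. Qed.

Lemma resample_GLt s j g : s \in GLt -> g \in GL -> resample s j g \in GLt.
Proof. by move=> /GLtP sG gG; apply/GLtP => i; rewrite ffunE; case: eqP. Qed.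

Lemma word_mx_resample s j g sw : j \notin unzip1 sw -> word_mx (resample s j g) sw = word_mx s sw.
Proof.
elim: sw => [//|[i b] sw IH] /=; rewrite inE negb_or => /andP[ji /IH ->].
by rewrite ffunE eq_sym (negPf ji).
Qed.

Lemma GL_gt0 : (0 < #|GL|)%N.
Proof. by apply/card_gt0P; exists 1%:M; exact: GL1. Qed.

(** Exchanging the new matrix with the one it replaces is an involution on pairs of a tuple and a
    matrix. *)
Lemma sum_resample j (F : {ffun L -> M} -> nat) :
  (#|GL| * \sum_(s in GLt) F s = \sum_(s in GLt) \sum_(g in GL) F (resample s j g))%N.
Proof.
rewrite mulnC big_distrl /=.
under eq_bigr do rewrite mulnC -sum_nat_const.
rewrite !pair_big /=.
rewrite (reindex_onto (fun p => (resample p.1 j p.2, p.1 j)) (fun p => (resample p.1 j p.2, p.1 j))) /=; last first.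
  move=> [s g] /= _; congr pair; last exact: resample_eq.
  by apply/ffunP => i; rewrite !ffunE; case: eqP => // ->.
apply: eq_bigl => -[s g] /=; rewrite resample_eq.
have -> : resample (resample s j g) j (s j) = s.
  by apply/ffunP => i; rewrite !ffunE; case: eqP => // ->.
rewrite eqxx andbT; apply/andP/andP => [[h1 h2]|[h1 h2]].
  split; last by move/GLtP/(_ j): h1; rewrite resample_eq.
  apply/GLtP => i; have [->//|ij] := eqVneq i j.
  by move/GLtP/(_ i): h1; rewrite ffunE (negPf ij).
split; first exact: resample_GLt.
exact: (GLtP _ h1).
Qed.

Definition total_fix sw := (\sum_(s in GLt) fixpts (word_mx s sw))%N.

Lemma total_fix_resample j sw c :
    (forall s, s \in GLt -> (\sum_(g in GL) fixpts (word_mx (resample s j g) sw) <= c * #|GL|)%N) ->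
  (total_fix sw <= c * #|GLt|)%N.
Proof.
move=> h; rewrite -(leq_pmul2l GL_gt0) (sum_resample j).
by rewrite mulnC -mulnA mulnCA -sum_nat_const; apply: leq_sum.
Qed.

Lemma total_fix_le sw : (total_fix sw <= n * #|GLt|)%N.
Proof. by rewrite mulnC -sum_nat_const; apply: leq_sum => s _; apply: fixpts_le. Qed.

Lemma sum_GLV (F : M -> nat) : (\sum_(g in GL) F (invmx g) = \sum_(g in GL) F g)%N.
Proof.
rewrite [RHS](reindex_inj (can_inj (@invmxK _ k))) /=.
by apply: eq_bigl => g; rewrite !inE unitmx_inv.
Qed.

Lemma sum_signed b (F : M -> nat) : (\sum_(g in GL) F (signed g b) = \sum_(g in GL) F g)%N.
Proof. by case: b; rewrite //= sum_GLV. Qed.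

Lemma unzip1_split sw p x q : unzip1 sw = p ++ x :: q ->
  exists sp b sq, [/\ sw = sp ++ (x, b) :: sq, unzip1 sp = p & unzip1 sq = q].
Proof.
elim: p sw => [|y p IH] [|[z b] sw] //= [-> e]; first by exists [::], b, sw.
by have [sp [c [sq [-> <- <-]]]] := IH _ e; exists ((y, b) :: sp), c, sq.
Qed.

Lemma count_split j (w : seq L) m : count_mem j w = m.+1 ->
  exists p q, [/\ w = p ++ j :: q, j \notin p & count_mem j q = m].
Proof.
elim: w => [//|x w IH] /=; have [->|ne] := eqVneq x j.
  by rewrite add1n => -[e]; exists [::], w.
rewrite add0n => /IH[p [q [-> jp e]]]; exists (x :: p), q; split=> //.
by rewrite inE negb_or eq_sym ne.
Qed.

Lemma total_fix_once sw j : count_mem j (unzip1 sw) = 1%N -> (total_fix sw <= #|GLt|)%N.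
Proof.
move=> /count_split[p [q [/unzip1_split[sp [b [sq [-> <- <-]]]] jp /eqP]]].
rewrite eqn0Ngt -has_count has_pred1 => jq.
rewrite -[leqRHS]mul1n; apply: (@total_fix_resample j) => s sG; rewrite mul1n.
have pG := word_mx_GL sp sG; have qG := word_mx_GL sq sG.
rewrite (eq_bigr (fun g => fixpts (signed g b *m (word_mx s sp *m word_mx s sq)))).
  by rewrite (sum_signed b (fun g => fixpts (g *m _))); apply: fixpts_resample1 => //; apply: GLM.
move=> g gG; have gbG := signed_GL b gG.
rewrite word_mx_cat /= resample_eq (word_mx_resample s g jp) (word_mx_resample s g jq) -mulmxA.
by rewrite fixptsC; [rewrite mulmxA | | apply: GLM].
Qed.

(** Two of the three signs agree. Cyclic rotation makes them the last two, and substituting the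
    inverse of [g] makes them positive; only the patterns [ppp] and [mpp] remain. *)
Lemma fixpts_resample3 b1 b2 b3 u v w : u \in GL -> v \in GL -> w \in GL ->
  (\sum_(g in GL) fixpts (signed g b1 *m u *m signed g b2 *m v *m signed g b3 *m w) <= 5 * #|GL|)%N.
Proof.
move=> uG vG wG.
have rot (c1 c2 c3 : bool) (u' v' w' : M) : u' \in GL -> v' \in GL -> w' \in GL ->
   (\sum_(g in GL) fixpts (signed g c1 *m u' *m signed g c2 *m v' *m signed g c3 *m w') =
    \sum_(g in GL) fixpts (signed g c2 *m v' *m signed g c3 *m w' *m signed g c1 *m u'))%N.
  move=> uG0 vG0 wG0; apply: eq_bigr => g gG.
  have [[h1 h2] h3] := (signed_GL c1 gG, signed_GL c2 gG, signed_GL c3 gG).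
  transitivity (fixpts ((signed g c1 *m u') *m (signed g c2 *m v' *m signed g c3 *m w'))).
    by rewrite !mulmxA.
  rewrite fixptsC; [by rewrite !mulmxA | exact: GLM |].
  exact: (GLM (GLM (GLM h2 vG0) h3) wG0).
have pp (c1 c2 : bool) (u' v' w' : M) : u' \in GL -> v' \in GL -> w' \in GL ->
   (\sum_(g in GL) fixpts (signed g c1 *m u' *m signed g c2 *m v' *m signed g c2 *m w') <= 5 * #|GL|)%N.
  move=> uG0 vG0 wG0.
  have [<-|ne] := eqVneq c1 c2.
    rewrite (sum_signed c1 (fun g => fixpts (g *m _ *m g *m _ *m g *m _))).
    exact: fixpts_resample_ppp.
  rewrite -(sum_signed c2) (eq_bigr (fun g => fixpts (invmx g *m u' *m g *m v' *m g *m w'))).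
    exact: fixpts_resample_mpp.
  move=> g _; have -> : signed (signed g c2) c2 = g by case: (c2); rewrite /signed ?invmxK.
  suff -> : signed (signed g c2) c1 = invmx g by [].
  by move: ne; rewrite /signed; case: (c1); case: (c2); rewrite ?eqxx.
have ppp c (u' v' w' : M) : u' \in GL -> v' \in GL -> w' \in GL ->
   (\sum_(g in GL) fixpts (signed g c *m u' *m signed g (~~ c) *m v' *m signed g c *m w') <= 5 * #|GL|)%N.
  by move=> h1 h2 h3; rewrite rot; [apply: pp | | |].
have ppm c (u' v' w' : M) : u' \in GL -> v' \in GL -> w' \in GL ->
   (\sum_(g in GL) fixpts (signed g c *m u' *m signed g c *m v' *m signed g (~~ c) *m w') <= 5 * #|GL|)%N.
  by move=> h1 h2 h3; rewrite rot; [apply: ppp; rewrite ?negbK | | |].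
have [->|/negPf n23] := eqVneq b2 b3; first exact: pp.
have -> : b3 = ~~ b2 by move: n23; case: (b2); case: (b3).
have [->|/negPf n12] := eqVneq b1 b2; first exact: ppm.
have -> : b2 = ~~ b1 by move: n12; case: (b1); case: (b2).
by rewrite negbK; apply: ppp.
Qed.

Lemma total_fix_triple sw j : count_mem j (unzip1 sw) = 3%N -> (total_fix sw <= 5 * #|GLt|)%N.
Proof.
move=> /count_split[p [q [/unzip1_split[sp [b [sq [-> <- <-]]]] jp]]].
move=> /count_split[{}p [{}q [/unzip1_split[sr [b' [{}sq [-> <- <-]]]] jr]]].
move=> /count_split[{}p [{}q [/unzip1_split[st [b'' [{}sq [-> <- <-]]]] jt /eqP]]].
rewrite eqn0Ngt -has_count has_pred1 => jq.
apply: (@total_fix_resample j) => s sG.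
have pG := word_mx_GL sp sG; have rG := word_mx_GL sr sG; have tG := word_mx_GL st sG; have qG := word_mx_GL sq sG.
rewrite (eq_bigr (fun g => fixpts (signed g b'' *m word_mx s st *m signed g b' *m word_mx s sr *m signed g b *m
   (word_mx s sp *m word_mx s sq)))); first by apply: fixpts_resample3 => //; apply: GLM.
move=> g gG; have [[h1 h2] h3] := (signed_GL b gG, signed_GL b' gG, signed_GL b'' gG).
rewrite word_mx_cat /= word_mx_cat /= word_mx_cat /= !resample_eq.
rewrite (word_mx_resample s g jp) (word_mx_resample s g jr) (word_mx_resample s g jt) (word_mx_resample s g jq).
exact: fixpts_rot3.
Qed.

(** The other [y] lies in [q ++ p1]. If the signs of [x] agree, resampling [x] suffices. If they
    differ, it gives at most [f + (n - f) / (n - 1)], where [f] counts the vectors fixed by the word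
    [q ++ p1]. This is increasing in [f], the single [y] brings the average of [f] down to at most
    1, and the value at [f = 1] is 2. *)
Lemma total_fix_crossing sw x y p1 p2 q :
    unzip1 sw = p1 ++ x :: p2 ++ x :: q ->
    [&& x \notin p1, x \notin p2 & x \notin q] ->
    count_mem y p2 = 1%N -> count_mem y (unzip1 sw) = 2%N ->
  (total_fix sw <= 2 * #|GLt|)%N.
Proof.
move=> e /and3P[x1 x2 x3] c1; rewrite e => c2.
have c3 : count_mem y (q ++ p1) = 1%N.
  have yx : (x == y) = false.
    apply: contraTF isT => /eqP xy; move: c1.
    by rewrite -xy (count_memPn x2).
  by move: c2; rewrite !count_cat /= count_cat /= yx c1; lia.
move: e => /unzip1_split[sp [b [sr [-> egf_ge]]]].
move=> /unzip1_split[st [b' [sq [-> et eq]]]].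
rewrite -egf_ge in x1 c3; rewrite -et in x2 c1; rewrite -eq in x3 c3.
move=> {egf_ge et eq c2 p1 p2 q}.
have E s : s \in GLt -> (\sum_(g in GL) fixpts (word_mx (resample s x g) (sp ++ (x, b) :: st ++ (x, b') :: sq))
   = \sum_(g in GL) fixpts (signed g b' *m word_mx s st *m signed g b *m word_mx s (sq ++ sp)))%N.
  move=> sG; have [[h1 h2] h3] := (word_mx_GL sp sG, word_mx_GL st sG, word_mx_GL sq sG).
  apply: eq_bigr => g gG; have [g1 g2] := (signed_GL b gG, signed_GL b' gG).
  rewrite word_mx_cat /= word_mx_cat /= word_mx_cat !resample_eq.
  rewrite (word_mx_resample s g x1) (word_mx_resample s g x2) (word_mx_resample s g x3).
  exact: fixpts_rot2.
have [bb|bb] := eqVneq b b'.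
  apply: (@total_fix_resample x) => s sG; rewrite E // -bb.
  rewrite (sum_signed b (fun g => fixpts (g *m _ *m g *m _))).
  by apply: fixpts_resample_same => //; apply: word_mx_GL.
have n3 := nz_gt1 k2.
have n1 : (0 < n.-1)%N by lia.
have hQ : (total_fix (sq ++ sp) <= #|GLt|)%N.
  by apply: (@total_fix_once _ y); rewrite /unzip1 map_cat.
rewrite -(leq_pmul2l GL_gt0) -(leq_pmul2l n1) (sum_resample x) big_distrr /=.
apply: (@leq_trans (\sum_(s in GLt) #|GL| * ((n - 2) * fixpts (word_mx s (sq ++ sp)) + n))).
  apply: leq_sum => s sG; rewrite E //.
  have := fixpts_resample_opp k2 (word_mx_GL st sG) (word_mx_GL (sq ++ sp) sG).
  have := fixpts_le (word_mx s (sq ++ sp)); move: (fixpts (word_mx s (sq ++ sp))) => f fn.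
  have -> : (n.-1 * f + (n - f) = (n - 2) * f + n)%N by nia.
  move=> h; apply: leq_trans h; rewrite leq_mul2l; apply/orP; right.
  rewrite -[leqRHS](sum_signed b' (fun g => fixpts (g *m word_mx s st *m invmx g *m word_mx s (sq ++ sp)))).
  apply: leq_sum => g gG; suff -> : signed g b = invmx (signed g b') by exact: leqnn.
  by move: bb; rewrite /signed; case: (b); case: (b'); rewrite ?eqxx ?invmxK.
rewrite -big_distrr /= big_split /= -big_distrr /= sum_nat_const mulnCA leq_mul2l.
apply/orP; right; rewrite mulnC; move: hQ; rewrite /total_fix.
move: (\sum_(s in _) _)%N #|GLt| => S N; case: n n3 => [|[|j]] // _ /=.
by rewrite subSS subSS subn0; nia.
Qed.
End Words.

(** * Sums over words *)

Section WSum.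
Variable L : finType.
Implicit Types (A : {set L}) (F G : seq L -> algC) (w : seq L) (x y : L) (l : nat).

(** Nesting the sums by letters, instead of summing over tuples, makes removal of the first letter
    definitional; all the counting below is induction on it. *)
Fixpoint wsum A l F : algC :=
  if l is l'.+1 then \sum_(x in A) wsum A l' (fun w => F (x :: w)) else F [::].

Lemma eq_wsum A l F G :
  (forall w, size w = l -> all (mem A) w -> F w = G w) -> wsum A l F = wsum A l G.
Proof.
elim: l F G => [|l IH] F G h /=; first exact: h.
by apply: eq_bigr => x xA; apply: IH => w sw aw; apply: h => /=; rewrite ?sw ?xA.
Qed.

Lemma ler_wsum A l F G :
  (forall w, size w = l -> all (mem A) w -> F w <= G w) -> wsum A l F <= wsum A l G.
Proof.
elim: l F G => [|l IH] F G h /=; first exact: h.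
by apply: ler_sum => x xA; apply: IH => w sw aw; apply: h => /=; rewrite ?sw ?xA.
Qed.

Lemma wsumD A l F G : wsum A l (fun w => F w + G w) = wsum A l F + wsum A l G.
Proof.
elim: l F G => [//|l IH] F G /=; rewrite -big_split.
by apply: eq_bigr => x _; rewrite IH.
Qed.

Lemma wsumZ A l c F : wsum A l (fun w => c * F w) = c * wsum A l F.
Proof.
elim: l F => [//|l IH] F /=; rewrite mulr_sumr.
by apply: eq_bigr => x _; rewrite IH.
Qed.

Lemma wsum0 A l : wsum A l (fun=> 0) = 0.
Proof. by elim: l => [//|l IH] /=; rewrite big1. Qed.

Lemma wsum_sum (I : finType) (P : pred I) A l (F : I -> seq L -> algC) :
  wsum A l (fun w => \sum_(i | P i) F i w) = \sum_(i | P i) wsum A l (F i).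
Proof.
elim: l F => [//|l IH] F /=; rewrite exchange_big; apply: eq_bigr => x _.
exact: (IH (fun i w => F i (x :: w))).
Qed.

Lemma wsumS A l F : wsum A l.+1 F = \sum_(x in A) wsum A l (fun w => F (x :: w)).
Proof. by []. Qed.
Arguments wsum : simpl never.

(** A word is a shuffle of its subwords inside and outside [A], and the binomial counts the
    positions. The first letter lies on one side or the other, and Pascal's rule joins the two
    cases. *)
Lemma wsum_shuffle A l F G :
  wsum setT l (fun w => F [seq x <- w | x \in A] * G [seq x <- w | x \notin A])
  = \sum_(a < l.+1) 'C(l, a)%:R * (wsum A a F * wsum (~: A) (l - a) G).
Proof.
elim: l F G => [|l IH] F G; first by rewrite big_ord1 /= mul1r.
rewrite [LHS]wsumS (bigID (mem A)) /=.
have -> : \sum_(x | (x \in setT) && (x \in A)) wsum setT l (fun w =>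
    F (if x \in A then x :: [seq x <- w | x \in A] else [seq x <- w | x \in A]) *
    G (if x \notin A then x :: [seq x <- w | x \notin A] else [seq x <- w | x \notin A]))
  = \sum_(a < l.+1) 'C(l, a)%:R * (wsum A a.+1 F * wsum (~: A) (l - a) G).
  transitivity (\sum_(x in A) \sum_(a < l.+1) 'C(l, a)%:R *
     (wsum A a (fun w => F (x :: w)) * wsum (~: A) (l - a) G)).
    apply: eq_big => [x|x /andP[_ xA]]; first by rewrite inE.
    by rewrite -IH; apply: eq_wsum => w _ _; rewrite xA.
  rewrite exchange_big; apply: eq_bigr => a _ /=.
  by rewrite wsumS mulr_suml mulr_sumr.
have -> : \sum_(x | (x \in setT) && (x \notin A)) wsum setT l (fun w =>
    F (if x \in A then x :: [seq x <- w | x \in A] else [seq x <- w | x \in A]) *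
    G (if x \notin A then x :: [seq x <- w | x \notin A] else [seq x <- w | x \notin A]))
  = \sum_(a < l.+1) 'C(l, a)%:R * (wsum A a F * wsum (~: A) (l - a).+1 G).
  transitivity (\sum_(x in ~: A) \sum_(a < l.+1) 'C(l, a)%:R *
     (wsum A a F * wsum (~: A) (l - a) (fun w => G (x :: w)))).
    apply: eq_big => [x|x /andP[_ xA]]; first by rewrite !inE.
    by rewrite -IH; apply: eq_wsum => w _ _; rewrite (negPf xA).
  rewrite exchange_big; apply: eq_bigr => a _ /=.
  by rewrite wsumS -2!mulr_sumr.
rewrite [RHS]big_ord_recl [X in _ + X = _]big_ord_recl /= !bin0 !mul1r !subn0.
transitivity (wsum A 0 F * wsum (~: A) l.+1 G +
   (\sum_(a < l.+1) 'C(l, a.+1)%:R * (wsum A a.+1 F * wsum (~: A) (l - a) G)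
   + \sum_(a < l.+1) 'C(l, a)%:R * (wsum A a.+1 F * wsum (~: A) (l - a) G))).
  rewrite [X in _ = _ + (X + _)]big_ord_recr /= (bin_small (ltnSn l)) mul0r addr0.
  rewrite [LHS]addrC -[LHS]addrA; congr (_ + (_ + _)).
  by apply: eq_bigr => i _ /=; rewrite /bump /= add1n subnSK.
congr (_ + _); rewrite -big_split; apply: eq_bigr => i _ /=.
by rewrite /bump /= add1n subSS binS natrD mulrDl.
Qed.

End WSum.

(** * * Exponential generating functions and the recursion [Y] *)

Section Egf.
(** Truncation at degree [N] keeps this a polynomial. Words of length [l] involve only coefficients
    up to [l], whence the recurring condition [l < N]. *)
Definition egf N (f : nat -> algC) : {poly algC} := \poly_(j < N) (f j / j`!%:R).

Lemma deriv_egf N f : (egf N f)^`() = egf N.-1 (f \o succn).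
Proof.
apply/polyP => j; rewrite coef_deriv !coef_poly /= ltn_predRL.
case: ifP => _; last by rewrite mul0rn.
rewrite -[LHS]mulr_natr factS natrM.
have h1 : j.+1%:R != 0 :> algC by rewrite pnatr_eq0.
have h2 : j`!%:R != 0 :> algC by rewrite pnatr_eq0 -lt0n fact_gt0.
by rewrite [RHS]/=; move: (f j.+1) (j.+1%:R) (j`!%:R) h1 h2 => a u v h1 h2; field; rewrite ?h1 ?h2.
Qed.

Lemma deriv_prod_seq (I : eqType) (r : seq I) (E : I -> {poly algC}) : uniq r ->
  (\prod_(x <- r) E x)^`()
  = \sum_(y <- r) \prod_(x <- r) (if x == y then (E x)^`() else E x).
Proof.
elim: r => [|y r IH] /=; first by rewrite !big_nil derivC.
case/andP => yr ur; rewrite !big_cons derivM IH // eqxx mulr_sumr; congr (_ + _).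
  congr (_ * _); apply: eq_big_seq => x xr; case: eqP => // e.
  by rewrite -e xr in yr.
apply: eq_big_seq => z zr; rewrite big_cons; case: eqP => // e.
by rewrite e zr in yr.
Qed.

Lemma deriv_prod (I : finType) (A : {set I}) (E : I -> {poly algC}) :
  (\prod_(x in A) E x)^`()
  = \sum_(y in A) \prod_(x in A) (if x == y then (E x)^`() else E x).
Proof.
rewrite -big_enum deriv_prod_seq ?enum_uniq // big_enum /=.
by apply: eq_bigr => y _; rewrite big_enum.
Qed.

Variable L : finType.
Implicit Types (A : {set L}) (x y : L) (l : nat).

(* Deleting the first letter shifts the weight of that letter, which on exponential
   generating functions is differentiation: the product rule gives the induction step. *)
Lemma wsum_egf A l (N : L -> nat) (a : L -> nat -> algC) :
    (forall x, x \in A -> (l < N x)%N) ->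
  wsum A l (fun w => \prod_(x in A) a x (count_mem x w))
  = l`!%:R * (\prod_(x in A) egf (N x) (a x))`_l.
Proof.
elim: l N a => [|l IH] N a hN; rewrite ?wsumS.
  rewrite mul1r /= -horner_coef0 horner_prod; apply: eq_bigr => x xA.
  by rewrite horner_coef0 coef_poly hN // divr1.
have -> : (l.+1)`!%:R * (\prod_(x in A) egf (N x) (a x))`_l.+1
   = l`!%:R * ((\prod_(x in A) egf (N x) (a x))^`())`_l.
  by rewrite coef_deriv factS natrM -mulr_natr; ring.
rewrite deriv_prod coef_sum mulr_sumr /=; apply: eq_bigr => y yA.
pose a' x := if x == y then a x \o succn else a x.
pose N' x := if x == y then (N x).-1 else N x.
transitivity (wsum A l (fun w => \prod_(x in A) a' x (count_mem x w))).
  apply: eq_wsum => w _ _; apply: eq_bigr => x _; rewrite /a' eq_sym.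
  by case: eqP; rewrite ?add1n ?add0n.
rewrite (IH N').
  suff -> : \prod_(x in A) egf (N' x) (a' x)
    = \prod_(x in A) (if x == y then (egf (N x) (a x))^`() else egf (N x) (a x)) by [].
  apply: eq_bigr => x _; rewrite /a' /N'.
  by case: eqP => // _; rewrite deriv_egf.
by move=> x xA; rewrite /N'; have := hN x xA; case: eqP => _; lia.
Qed.

Definition zero_or_ge p (j : nat) := (j == 0%N) || (p <= j)%N.
Definition egf_ge N p : {poly algC} := egf N (fun j => (zero_or_ge p j)%:R).

Definition counts_ge A p w := [forall x in A, zero_or_ge p (count_mem x w)].

Lemma prod_bool A (b : L -> bool) :
  \prod_(x in A) (b x)%:R = [forall x in A, b x]%:R :> algC.
Proof.
have [/forall_inP h|] := boolP [forall x in A, b x].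
  by rewrite big1 // => x /h ->.
rewrite negb_forall_in => /exists_inP[x xA /negPf bx].
by rewrite (bigD1 x) //= bx mul0r.
Qed.

Lemma wsum_counts_ge A l N p : (l < N)%N ->
  wsum A l (fun w => (counts_ge A p w)%:R) = l`!%:R * (egf_ge N p ^+ #|A|)`_l.
Proof.
move=> lN; rewrite -prodr_const -(wsum_egf (N := fun=> N)) //.
by apply: eq_wsum => w _ _; rewrite prod_bool.
Qed.

(** [E ^ D - 1] is a multiple of [E - 1], which has no term of degree below [p]. *)
Lemma coef_egf_ge_small N p D l : (l < N)%N -> (0 < l)%N -> (l < p)%N -> (egf_ge N p ^+ D)`_l = 0.
Proof.
move=> lN l0 lp; have : (egf_ge N p ^+ D - 1)`_l = 0.
  rewrite subrX1 coefM big1 // => i _.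
  suff -> : (egf_ge N p - 1)`_i = 0 by rewrite mul0r.
  have il : (i <= l)%N by rewrite -ltnS.
  rewrite coefB coef1 coef_poly (leq_ltn_trans il lN) /zero_or_ge.
  case: eqP => [->|/eqP i0] /=; first by rewrite divr1 subrr.
  by rewrite leqNgt (leq_ltn_trans il lp) mul0r subrr.
by rewrite coefB coef1 eqn0Ngt l0 subr0.
Qed.

Lemma coef_egf_ge_0 N p D : (0 < N)%N -> (egf_ge N p ^+ D)`_0 = 1.
Proof.
move=> N0; rewrite -horner_coef0 horner_exp horner_coef0 coef_poly N0 /zero_or_ge /=.
by rewrite divr1 expr1n.
Qed.

Lemma egf_ge_rec N p : (p < N)%N -> (0 < p)%N -> egf_ge N p = egf_ge N p.+1 + (p`!%:R^-1) *: 'X^p.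
Proof.
move=> pN p0; apply/polyP => j; rewrite coefD coefZ coefXn !coef_poly /zero_or_ge.
have [->|jp] := eqVneq j p; first by rewrite pN ltnn leqnn orbF eqn0Ngt p0 /= mul0r add0r mulr1 mul1r.
by rewrite mulr0 addr0 (leq_eqVlt p) (eq_sym p) (negPf jp).
Qed.

Lemma sum_nat_widen0 a b (g : nat -> algC) : (a <= b)%N ->
  (forall i, (a <= i < b)%N -> g i = 0) -> \sum_(0 <= i < a) g i = \sum_(0 <= i < b) g i.
Proof.
move=> ab g0; rewrite [RHS](big_cat_nat (n := a)) //= [X in _ = _ + X]big_nat_cond.
by rewrite [X in _ = _ + X]big1 ?addr0 // => i /andP[/g0].
Qed.

(** The recursion is the binomial expansion of [(egf_ge N p.+1 + X^p / p!) ^ D]: the index [i] is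
    the number of letters occurring exactly [p] times. The condition on [fuel] guarantees [l < p] by
    the last unit of fuel. *)
Lemma Yf_coef N fuel p l D : (l < N)%N -> (0 < p)%N -> (0 < fuel)%N -> (l.+2 <= fuel + p)%N ->
  Yf fuel p 0 l D = l`!%:R * (egf_ge N p ^+ D)`_l.
Proof.
elim: fuel p l D => [//|fuel IH] p l D lN p0 _ hf /=.
case: eqP => [->|/eqP l0]; first by rewrite coef_egf_ge_0 ?mulr1 //; lia.
rewrite -lt0n in l0.
case: ltnP => [lp|pl]; first by rewrite coef_egf_ge_small // mulr0.
rewrite (egf_ge_rec (leq_ltn_trans pl lN) p0) exprDn coef_sum.
pose g i := 'C(D, i)%:R * p`!%:R ^- i * (if (p * i <= l)%N then (egf_ge N p.+1 ^+ (D - i))`_(l - p * i) else 0).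
transitivity (l`!%:R * \sum_(0 <= i < (l %/ p).+1) g i).
  rewrite mulr_sumr big_nat_cond [RHS]big_nat_cond; apply: eq_bigr => i /andP[/andP[_ il] _].
  have pil : (p * i <= l)%N by rewrite mulnC -leq_divRL.
  rewrite /g pil IH; [|lia..].
  have nz : ((l - p * i)`!)%:R != 0 :> algC by rewrite pnatr_eq0 -lt0n fact_gt0.
  move: (egf_ge _ _ ^+ _) => E; field.
  by rewrite nz andbT expf_neq0 // pnatr_eq0 -lt0n fact_gt0.
congr (_ * _); transitivity (\sum_(0 <= i < D.+1) g i); last first.
  rewrite big_mkord; apply: eq_bigr => i _; rewrite /g coefMn -[RHS]mulr_natl.
  rewrite exprZn -exprM -scalerAr coefZ coefMXn exprVn -mulrA.
  by rewrite ltnNge; case: ifP.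
have out1 i : ((l %/ p).+1 <= i)%N -> g i = 0.
  move=> h; rewrite /g ifF ?mulr0 //; apply/negbTE; rewrite -ltnNge mulnC.
  by rewrite -ltn_divLR.
have out2 i : (D.+1 <= i)%N -> g i = 0.
  by move=> h; rewrite /g bin_small // !mul0r.
(* The recursion stops at [l %/ p] and the binomial expansion at [D]; the summand vanishes beyond
   each, so the two sums agree. *)
have [h|h] := leqP (l %/ p).+1 D.+1.
  by apply: sum_nat_widen0 => // i /andP[/out1].
by apply/esym/sum_nat_widen0 => [|i /andP[/out2]]; first exact: ltnW.
Qed.

Lemma Y0E N p l D : (l < N)%N -> (0 < p)%N -> Y p 0 l D = l`!%:R * (egf_ge N p ^+ D)`_l.
Proof. by move=> lN p0; apply: Yf_coef => //; lia. Qed.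

(** Starting the sum at 1 drops the term [i = 0], which is [Y p.+1 0 l D]. For [l = 0] the left side
    is 0 by the second clause of [Y], and the right side is 1 - 1. *)
Lemma Y1E p l D : (0 < p)%N -> Y p 1 l D = Y p 0 l D - Y p.+1 0 l D.
Proof.
move=> p0; rewrite (Y0E (N := l.+1) (p := p.+1)) //.
have [lp|pl] := ltnP l p.
  rewrite (Y0E (N := l.+1)) // /Y /= lp.
  have [->|l0] := eqVneq l 0%N; first by rewrite !coef_egf_ge_0 ?subrr.
  by rewrite !coef_egf_ge_small ?mulr0 ?subrr ?lt0n // ltnW.
have l0 : (0 < l)%N by lia.
rewrite /Y [Yf l.+2 p 1 l D]/= [Yf l.+2 p 0 l D]/= ltnNge pl /= eqn0Ngt l0 /=.
rewrite [X in _ = X - _]big_ltn // -/(Yf l.+1 p.+1 0 _ _).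
rewrite (Yf_coef (N := l.+1) (fuel := l.+1) (p := p.+1)) ?muln0 ?subn0 //; last by lia.
rewrite bin0 expr0 invr1 divff ?mul1r; last by rewrite pnatr_eq0 -lt0n fact_gt0.
by rewrite addrAC subrr add0r.
Qed.

Lemma wsum_counts_ge0 A p l : (0 < p)%N -> wsum A l (fun w => (counts_ge A p w)%:R) = Y p 0 l #|A|.
Proof. by move=> p0; rewrite (@wsum_counts_ge A l l.+1 p) // (Y0E (N := l.+1)). Qed.

Lemma counts_geS A p w : counts_ge A p.+1 w -> counts_ge A p w.
Proof.
move=> /forall_inP h; apply/forall_inP => x /h; rewrite /zero_or_ge.
by case: eqP => //= _; apply: ltnW.
Qed.

Lemma wsum_counts_ge1 A p l : (0 < p)%N ->
  wsum A l (fun w => (counts_ge A p w && ~~ counts_ge A p.+1 w)%:R) = Y p 1 l #|A|.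
Proof.
move=> p0; rewrite Y1E // -!wsum_counts_ge0 // -[X in _ - X]mul1r -mulNr -wsumZ -wsumD.
apply: eq_wsum => w _ _; have := @counts_geS A p w.
by case: (counts_ge A p w); case: (counts_ge A p.+1 w) => // h; rewrite ?mulN1r ?mulr0 ?subrr ?subr0 ?addr0 //; move: (h isT).
Qed.

End Egf.

(** * Noncrossing words *)

Section NC.
Variable L : finType.
Implicit Types (A I : {set L}) (w p q st : seq L) (x y : L) (l : nat).

(* [st] holds the letters read once so far, the latest on top; a letter occurring for the second time
   must be on top. *)
Fixpoint stack_nc st w :=
  if w is x :: w' then
    if ohead st == Some x then stack_nc (behead st) w' else (x \in w') && stack_nc (x :: st) w'
  else nilp st.

(** [p] is the part already read, and [st] holds the letters of [I] met once in it, in reverse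
    reading order. Reading gets stuck when [x] returns while another letter [y] is on top: [y] was
    opened after [x] and is still open, so exactly one [y] lies between the two [x]. *)
Lemma nc_crossing I w st p q :
    w = p ++ q -> I = [set x | count_mem x w == 2] -> ~~ stack_nc st [seq x <- q | x \in I] ->
    uniq st -> {subset st <= I} -> subseq (rev st) p ->
    (forall x, x \in st -> count_mem x p = 1%N) ->
    (forall x, x \in I -> x \notin st -> count_mem x p != 1%N) ->
  exists x y p1 p2 r, [/\ w = p1 ++ x :: p2 ++ x :: r,
    [&& x \notin p1, x \notin p2 & x \notin r], count_mem y p2 = 1%N & count_mem y w = 2%N].
Proof.
move=> ew eI; elim: q p st ew => [|x q IH] p st ew /=.
  (* A letter still open at the end would occur once in [w], although every letter of [I] occurs
     twice. *)
  case: st => [//|y st] _ _ sI _ c1 _; exfalso.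
  have : y \in I by apply: sI; rewrite mem_head.
  by rewrite eI inE ew cats0 c1 ?mem_head.
have ew' : w = rcons p x ++ q by rewrite cat_rcons.
have cr z : count_mem z (rcons p x) = (count_mem z p + (x == z))%N.
  by rewrite -cats1 count_cat /= addn0.
case: ifPn => [xI|xI]; last first.
  move=> hnc ust sI ss c1 c2; apply: (IH _ _ ew' hnc ust sI).
  - exact: subseq_trans ss (subseq_rcons _ _).
  - move=> z zst; rewrite cr c1 //; have [e|//] := eqVneq x z.
    by rewrite e sI in xI.
  - move=> z zI zst; rewrite cr; have [e|_] := eqVneq x z; last by rewrite /= addn0 c2.
    by rewrite e zI in xI.
have cx : (count_mem x p + (1 + count_mem x q) = 2)%N.
  by move: xI; rewrite eI inE ew count_cat /= eqxx => /eqP.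
rewrite /=; case: ifPn => [|hd].
  case: st => [//|y st] /= /eqP[->] hnc /andP[xst ust] sI ss c1 c2.
  apply: (IH _ _ ew' hnc ust).
  - by move=> z zst; apply: sI; rewrite inE zst orbT.
  - apply: subseq_trans (subseq_rcons _ _); apply: subseq_trans ss.
    by rewrite rev_cons subseq_rcons.
  - move=> z zst; rewrite cr c1 ?inE ?zst ?orbT //; have [e|//] := eqVneq x z.
    by rewrite e zst in xst.
  - move=> z zI zst; rewrite cr; have [<-|ne] := eqVneq x z.
      by rewrite c1 ?mem_head.
    by rewrite /= addn0 c2 // inE negb_or eq_sym ne.
have [xq|xq] := boolP (x \in [seq x <- q | x \in I]); rewrite /=.
  have cq : (0 < count_mem x q)%N.
    by rewrite -has_count has_pred1; move: xq; rewrite mem_filter => /andP[].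
  move=> hnc ust sI ss c1 c2.
  have xst : x \notin st.
    by apply/negP => /c1 c; move: cx cq; rewrite c; case: (count_mem x q).
  apply: (IH _ _ ew' hnc) => /=.
  - by rewrite xst.
  - by move=> z; rewrite inE => /predU1P[->|/sI].
  - by rewrite rev_cons -!cats1 cat_subseq.
  - move=> z; rewrite inE cr; have [->|ne] := eqVneq z x; first by lia.
    by move=> zst; rewrite c1.
  - move=> z zI; rewrite inE negb_or cr eq_sym => /andP[/negPf -> zst].
    by rewrite /= addn0 c2.
move=> _ ust sI ss c1 c2.
have xq' : x \notin q by move: xq; rewrite mem_filter xI.
have cp : count_mem x p = 1%N by move: cx; rewrite (count_memPn xq'); lia.
have xst : x \in st by apply: contraTT isT => /(c2 _ xI); rewrite cp.
case: st hd ust sI ss c1 c2 xst => [//|y st] /= hd /andP[yst ust] sI ss c1 c2.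
rewrite inE => /predU1P[xy|xst]; first by rewrite xy eqxx in hd.
have xp : x \in p by rewrite -has_pred1 has_count cp.
case/splitPr: p / xp ew ew' cp cx ss c1 c2 cr => p1 p2 ew _ cp cx ss c1 _ _.
have xp12 : (x \notin p1) && (x \notin p2).
  by rewrite -!has_pred1 !has_count; move: cp; rewrite count_cat /= eqxx; lia.
have yx : x != y by apply: contraNneq yst => <-.
have cyp : count_mem y (p1 ++ x :: p2) = 1%N by apply: c1; rewrite mem_head.
exists x, y, p1, p2, q; rewrite -{1}cat_cons catA; split=> //.
- by case/andP: xp12 => -> ->.
(* [rev st] is in reading order and ends with [y], so [x] precedes [y] in the part read; as [p1] has
   no [x], this [y] is in [p2]. *)
- have yp2 : y \in p2.
    have : subseq [:: x; y] (p1 ++ x :: p2).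
      apply: subseq_trans ss; rewrite rev_cons -cats1 -[[:: x; y]]/([:: x] ++ [:: y]).
      by rewrite cat_subseq // sub1seq mem_rev.
    have /andP[xp1 _] := xp12.
    elim: p1 xp1 {ew cp cx ss c1 xp12 cyp} => [_|z p1 IHp] /=; first by rewrite eqxx sub1seq.
    by rewrite inE negb_or => /andP[/negPf -> /IHp].
  have : (0 < count_mem y p2)%N by rewrite -has_count has_pred1.
  move: cyp; rewrite count_cat /= (negPf yx).
  by move: (count_mem y p1) (count_mem y p2) => a b; clear; lia.
- by have : y \in I by [apply: sI; rewrite mem_head]; rewrite eI inE => /eqP.
Qed.

(* Ballot numbers with labels: the number of ways to finish reading with [h] letters on the stack and
   [o] letters still unread; [nc_count o 0] is the Catalan number times [o`!]. *)
Definition nc_count (o h : nat) : algC := (h.+1 * (2 * o + h)`!)%:R / ((o + h).+1)`!%:R.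

Lemma nc_count_ge0 o h : 0 <= nc_count o h.
Proof. by rewrite divr_ge0 ?ler0n. Qed.

Lemma fact_neq0 j : j`!%:R != 0 :> algC.
Proof. by rewrite pnatr_eq0 -lt0n fact_gt0. Qed.

(** The ballot recurrence: the next letter either closes the top of the stack or opens one of the
    [o] unread letters, which then awaits its second occurrence. *)
Lemma nc_count_recS o h : nc_count o h.+1 = nc_count o h + o%:R * nc_count o.-1 h.+2.
Proof.
rewrite /nc_count; case: o => [|o].
  rewrite mul0r addr0 muln0 !add0n -!factS !divff ?fact_neq0 //.
have -> : (2 * o.+1 + h.+1 = (2 * o + h.+2).+1)%N by lia.
have -> : (2 * o.+1 + h = 2 * o + h.+2)%N by lia.
have -> : ((o.+1 + h.+1).+1 = (o + h.+2).+1)%N by lia.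
have -> : ((o.+1 + h).+1 = o + h.+2)%N by lia.
rewrite /= !factS !natrM; have := fact_neq0 (o + h.+2).
have : (o + h.+2).+1%:R != 0 :> algC by rewrite pnatr_eq0.
move: (_`!%:R) (_`!%:R) => M K.
move=> h1 h2; field; rewrite h2 /=.
by suff -> : 1 + (o%:R + (2 + h%:R)) = (o + h.+2).+1%:R :> algC by []; ring.
Qed.

Lemma nc_count_rec0 o : (0 < o)%N -> nc_count o 0 = o%:R * nc_count o.-1 1.
Proof.
case: o => [//|o] _; rewrite /nc_count succnK !addn0 !addn1.
have -> : (2 * o.+1 = (2 * o).+2)%N by lia.
rewrite (factS (2 * o).+1) mul1n !natrM !mulrA; congr (_ * _ / _).
by ring.
Qed.

Definition multiplicities I st w := [forall x, count_mem x w == (x \in I).*2 + (x \in st)]%N.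

Lemma wsum_nc A I st l : uniq st -> [disjoint I & st] -> l = (2 * #|I| + size st)%N ->
  wsum A l (fun w => (multiplicities I st w && stack_nc st w)%:R) <= nc_count #|I| (size st).
Proof.
elim: l I st => [|l IH] I st ust dIs el.
  move/esym/eqP: el; rewrite addn_eq0 muln_eq0 /= => /andP[/eqP -> /eqP/size0nil ->].
  by rewrite /nc_count /wsum /= mul1n !fact0 divr1 ler_nat; case: (_ && _).
rewrite wsumS.
have bI x : x \in I -> wsum A l (fun w => (multiplicities I st (x :: w) && stack_nc st (x :: w))%:R)
    <= nc_count #|I|.-1 (size st).+1.
  move=> xI; have xst : x \notin st by rewrite (disjointFr dIs).
  have cI : #|I| = (#|I :\ x|).+1 by rewrite (cardsD1 x) xI.
  apply: le_trans (_ : wsum A l (fun w => (multiplicities (I :\ x) (x :: st) w && stack_nc (x :: st) w)%:R) <= _).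
    apply: ler_wsum => w _ _; rewrite ler_nat.
    have [/andP[/forallP d h]|//] := boolP (multiplicities I st (x :: w) && stack_nc st (x :: w)).
    apply: eq_leq; apply/esym; congr nat_of_bool; apply/andP; split.
      apply/forallP => y; have := d y; rewrite /= !inE; have [->|ne] := eqVneq y x.
        by rewrite ?eqxx xI (negPf xst) /=; lia.
      by rewrite ?(negPf ne).
    move: h => /=; case: st xst {ust dIs el d} => [_|z st] /=; first by case/andP.
    rewrite inE negb_or => /andP[zx _]; case: eqP => [[e]|_]; last by case/andP.
    by rewrite e eqxx in zx.
  have -> : #|I|.-1 = #|I :\ x| by rewrite cI.
  apply: (IH (I :\ x) (x :: st)); rewrite /= ?xst //; last by lia.
  rewrite disjoint_sym disjoint_cons !inE eqxx /= disjoint_sym.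
  by apply: disjointWl dIs; apply: subsetDl.
(* Such a letter would have to occur again later, but outside [I] its prescribed multiplicity is at
   most 1. *)
have bO x : x \notin I -> ohead st != Some x ->
    wsum A l (fun w => (multiplicities I st (x :: w) && stack_nc st (x :: w))%:R) = 0.
  move=> xI hd; rewrite -(wsum0 A l); apply: eq_wsum => w _ _.
  case: andP => // -[/forallP/(_ x)]; rewrite /= eqxx (negPf xI) (negPf hd) => cx /andP[xw _].
  have : (0 < count_mem x w)%N by rewrite -has_count has_pred1.
  by move: cx; case: (x \in st) => /=; lia.
have bS : \sum_(x in A | x \in I) wsum A l (fun w => (multiplicities I st (x :: w) && stack_nc st (x :: w))%:R)
   <= #|I|%:R * nc_count #|I|.-1 (size st).+1.
  apply: le_trans (_ : \sum_(x in A | x \in I) nc_count #|I|.-1 (size st).+1 <= _).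
    by apply: ler_sum => x /andP[_ /bI].
  rewrite sumr_const -[leLHS]mulr_natl ler_wpM2r ?nc_count_ge0 // ler_nat.
  by apply: subset_leq_card; apply/subsetP => x /andP[].
rewrite (bigID (mem I)) /=.
case: st ust dIs el bI bO bS => [|y st] /= ust dIs el bI bO bS.
  rewrite [X in _ + X]big1 ?addr0; last by move=> x /andP[_ xI]; apply: bO.
  by rewrite nc_count_rec0 //; lia.
case/andP: ust => yst ust.
have yI : y \notin I by rewrite (disjointFl dIs) ?mem_head.
have bY : wsum A l (fun w => (multiplicities I (y :: st) (y :: w) && stack_nc (y :: st) (y :: w))%:R)
    <= nc_count #|I| (size st).
  apply: le_trans (_ : wsum A l (fun w => (multiplicities I st w && stack_nc st w)%:R) <= _).
    apply: ler_wsum => w _ _; rewrite ler_nat.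
    have [/andP[/forallP d h]|//] := boolP (multiplicities _ _ (y :: w) && _).
    apply: eq_leq; apply/esym; congr nat_of_bool; apply/andP; split.
      apply/forallP => z; have := d z; rewrite /= !inE; have [->|ne] := eqVneq z y.
        by rewrite ?eqxx (negPf yI) (negPf yst) /=; lia.
      by rewrite ?(negPf ne).
    by move: h => /=; rewrite eqxx.
  apply: IH => //; last by move: el => /=; lia.
  by apply: disjointWr dIs; apply/subsetP => z; rewrite inE => ->; rewrite orbT.
rewrite nc_count_recS addrC lerD //.
have [yA|yA] := boolP (y \in A); last first.
  rewrite big1 ?nc_count_ge0 // => x /andP[xA xI]; apply: bO => //=.
  by apply: contraNneq yA => -[->].
rewrite (bigD1 y) ?yA //= big1 ?addr0 // => x /andP[/andP[_ xI] xy]; apply: bO => //=.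
by apply: contraNneq xy => -[->].
Qed.

End NC.

(** * Traces as sums over words *)

Section TraceWords.
Variables (k d : nat).
Local Notation V := 'cV['F_2]_k.
Local Notation M := 'M['F_2]_k.
Local Notation GL := (GL k).
Local Notation L := 'I_d.
Local Notation GLt := (GLtuples k d).
Local Notation N := #|{: nzvec k}|.
Implicit Types (g h : M) (s : {ffun L -> M}) (b : bool) (w : seq L) (i j : 'I_N).

Definition vec_of i : V := val (enum_val i).

Lemma vec_neq0 i : vec_of i != 0.
Proof. exact: (valP (enum_val i)). Qed.

Lemma vec_inj : injective vec_of.
Proof. by move=> i j /val_inj /enum_val_inj. Qed.

Lemma vec_surj (x : V) : x != 0 -> exists i, vec_of i = x.
Proof.
move=> x0; exists (enum_rank (Sub x x0 : nzvec k)).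
by rewrite /vec_of enum_rankK SubK.
Qed.

Lemma sum_vec (R : nmodType) (F : V -> R) : \sum_i F (vec_of i) = \sum_(x | x != 0) F x.
Proof.
rewrite (reindex_onto (fun u : nzvec k => enum_rank u) enum_val) /=; last first.
  by move=> i _; rewrite enum_valK.
rewrite [RHS](reindex_omap (val : nzvec k -> V) insub) /=; last first.
  by move=> x x0; rewrite insubT.
apply: eq_big => [u|u _]; last by rewrite /vec_of enum_rankK.
by rewrite enum_rankK eqxx valK eqxx andbT (valP u).
Qed.

Lemma card_nzvec : N = nzcount k.
Proof.
rewrite -[LHS]card_ord -sum1_card -[RHS](card_nz k) -[RHS]sum1_card.
exact: (sum_vec (fun=> 1%N)).
Qed.

Definition vec_perm_mx g : 'M[algC]_N := \matrix_(i, j) (g *m vec_of i == vec_of j)%:R.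

Lemma vec_perm_row g i : g \in GL -> \sum_j vec_perm_mx g i j = 1.
Proof.
move=> gG; have [j0 ej] : exists j, vec_of j = g *m vec_of i.
  by apply: vec_surj; rewrite GL_eq0 ?vec_neq0.
rewrite (bigD1 j0) //= big1 ?addr0; first by rewrite mxE ej eqxx.
by move=> j jj; rewrite mxE -ej (inj_eq vec_inj) eq_sym (negPf jj).
Qed.

(** Rows index sources, so matrix products compose from left to right; accordingly [word_mx] lets
    the head of a word act first. *)
Lemma vec_perm_mul g h : g \in GL -> vec_perm_mx g *m vec_perm_mx h = vec_perm_mx (h *m g).
Proof.
move=> gG; apply/matrixP => i l; rewrite !mxE.
have [j0 ej] : exists j, vec_of j = g *m vec_of i.
  by apply: vec_surj; rewrite GL_eq0 ?vec_neq0.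
rewrite (bigD1 j0) //= big1 ?addr0; first by rewrite !mxE ej eqxx mul1r mulmxA.
by move=> j jj; rewrite mxE -ej (inj_eq vec_inj) eq_sym (negPf jj) mul0r.
Qed.

Lemma vec_perm1 : vec_perm_mx 1%:M = 1%:M.
Proof. by apply/matrixP => i j; rewrite !mxE mul1mx (inj_eq vec_inj). Qed.

Lemma vec_perm_tr g : g \in GL -> (vec_perm_mx g)^T = vec_perm_mx (invmx g).
Proof.
move=> gG; apply/matrixP => i j; rewrite !mxE; congr (nat_of_bool _)%:R.
have ug : g \in unitmx by rewrite inE in gG.
by rewrite -[RHS](inj_eq (GL_inj gG)) (mulKVmx ug) eq_sym.
Qed.

Lemma trace_vec_perm g : \tr (vec_perm_mx g) = (fixpts g)%:R.
Proof.
rewrite /fixpts natr_sum -(sum_vec (fun x => (g *m x == x)%:R)).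
by apply: eq_bigr => i _; rewrite mxE.
Qed.

Definition half_adj s b : 'M[algC]_N := d%:R^-1 *: \sum_x vec_perm_mx (signed (s x) b).

Lemma half_adj_true s : half_adj s true = biadj s.
Proof.
apply/matrixP => i j; rewrite !mxE summxE mulrC; congr (_ / _).
rewrite -sum1_card natr_sum [RHS]big_mkcond /=. apply: eq_bigr => x _.
by rewrite !mxE inE; case: ifP.
Qed.

Lemma half_adj_false s : s \in GLt -> half_adj s false = (biadj s)^T.
Proof.
move=> /GLtP sG; rewrite -half_adj_true; apply/matrixP => i j.
rewrite !mxE !summxE; congr (_ * _); apply: eq_bigr => x _.
by transitivity ((vec_perm_mx (s x))^T i j); [rewrite vec_perm_tr | rewrite mxE].
Qed.

Fixpoint altmx s b l : 'M[algC]_N :=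
  if l is l'.+1 then half_adj s b *m altmx s (~~ b) l' else 1%:M.

Fixpoint altw b w : seq (L * bool) :=
  if w is x :: w' then (x, b) :: altw (~~ b) w' else [::].

Lemma unzip1_altw b w : unzip1 (altw b w) = w.
Proof. by elim: w b => //= x w IH b; rewrite IH. Qed.

(** The left factor [C] is there for the induction: each step absorbs one letter into it. *)
Lemma altmx_trace s b l (C : 'M[algC]_N) : s \in GLt ->
  \tr (C *m altmx s b l)
  = d%:R ^- l * wsum setT l (fun w => \tr (C *m vec_perm_mx (word_mx s (altw b w)))).
Proof.
move=> sG; elim: l b C => [|l IH] b C.
  by rewrite expr0 invr1 mul1r /= /wsum /= vec_perm1.
rewrite [altmx _ _ _]/= wsumS mulmxA {1}/half_adj -scalemxAr -scalemxAl linearZ /=.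
rewrite mulmx_sumr mulmx_suml raddf_sum /= exprS invfM -mulrA; congr (_ * _).
rewrite mulr_sumr; apply: eq_big => [x|x _]; first by rewrite inE.
rewrite IH; congr (_ * _); apply: eq_wsum => w _ _.
by rewrite -mulmxA vec_perm_mul //; apply: signed_GL; move/GLtP: sG.
Qed.

Lemma altmx_true s m : s \in GLt ->
  altmx s true (2 * m) = (biadj s *m (biadj s)^T) ^+ m.
Proof.
move=> sG; elim: m => [|m IH]; first by rewrite muln0 expr0.
rewrite mulnS exprS -IH /= half_adj_true half_adj_false //; exact: mulmxA.
Qed.

Lemma trace_words s m : s \in GLt ->
  \tr ((biadj s *m (biadj s)^T) ^+ m)
  = d%:R ^- (2 * m) * wsum setT (2 * m) (fun w => (fixpts (word_mx s (altw true w)))%:R).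
Proof.
move=> sG; rewrite -altmx_true // -[altmx _ _ _]mul1mx altmx_trace //.
by congr (_ * _); apply: eq_wsum => w _ _; rewrite mul1mx trace_vec_perm.
Qed.

Lemma biadj_real s : biadj s \is a mxOver Num.real.
Proof. by apply/mxOverP => i j; rewrite mxE rpred_div ?realn. Qed.

Lemma half_adj_row s b i : s \in GLt -> (0 < d)%N -> \sum_j half_adj s b i j = 1.
Proof.
move=> sG d0; rewrite /half_adj.
transitivity (d%:R^-1 * \sum_(x : L) \sum_j vec_perm_mx (signed (s x) b) i j).
  rewrite exchange_big mulr_sumr; apply: eq_bigr => j _.
  by rewrite mxE summxE.
rewrite (eq_bigr (fun=> 1)); last by move=> x _; rewrite vec_perm_row //; apply: signed_GL; move/GLtP: sG.
by rewrite sumr_const card_ord mulVf // pnatr_eq0 -lt0n.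
Qed.

Lemma mu2_trace s m : s \in GLt -> (0 < d)%N -> (2 <= k)%N -> (0 < m)%N ->
  0 <= mu2 (schreier_adj s) /\
  mu2 (schreier_adj s) ^+ (2 * m)
    <= d%:R ^- (2 * m) * wsum setT (2 * m) (fun w => (fixpts (word_mx s (altw true w)))%:R) - 1.
Proof.
move=> sG d0 k2 m0; rewrite -trace_words //; apply: mu2_le => //.
- exact: biadj_real.
- by move=> i; rewrite -half_adj_true half_adj_row.
- move=> j; rewrite -(@half_adj_row s false j sG d0) half_adj_false //.
  by apply: eq_bigr => i _; rewrite [RHS]mxE.
- by rewrite card_nzvec; apply: ltn_trans (nz_gt1 k2).
Qed.

End TraceWords.

(** * The averaged bound *)

Section WordSum.
Variables (k d : nat).
Hypothesis k2 : (2 <= k)%N.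
Local Notation n := (nzcount k).
Local Notation L := 'I_d.
Local Notation GLt := (GLtuples k d).
Implicit Types (w u v : seq L) (x y : L) (I : {set L}).

(** These weights apply to the subwords inside and outside a candidate set [I] of paired letters.
    Testing them separately lets [wsum_shuffle] factor the sum over words. *)
Definition pairW I u : algC := (multiplicities I [::] u && stack_nc [::] u)%:R.
Definition restW I v : algC :=
  5%:R * (counts_ge (~: I) 3 v && ~~ counts_ge (~: I) 4 v)%:R + n%:R * (counts_ge (~: I) 4 v)%:R.

Lemma pairW_ge0 I u : 0 <= pairW I u. Proof. exact: ler0n. Qed.
Lemma restW_ge0 I v : 0 <= restW I v.
Proof. by rewrite addr_ge0 // mulr_ge0 ?ler0n. Qed.

Lemma count_mem_filter (P : pred L) w x :
  count_mem x [seq z <- w | P z] = (P x * count_mem x w)%N.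
Proof.
elim: w => [|z w IH] /=; first by rewrite muln0.
by case Pz: (P z) => /=; rewrite IH mulnDr; have [<-|_] := eqVneq z x; rewrite ?muln0 ?Pz.
Qed.

Lemma not_counts_ge A p w : ~~ counts_ge A p w -> exists2 x : L, x \in A & (0 < count_mem x w < p)%N.
Proof.
rewrite negb_forall_in => /exists_inP[x xA]; rewrite /zero_or_ge negb_or -lt0n -ltnNge => h.
by exists x.
Qed.

(** All summands are nonnegative, so one that covers [w] suffices. If no letter occurs once, take
    for [I] the letters occurring exactly twice: a crossing in [I] is covered by the term with
    coefficient 2, and otherwise the summand of [I] itself gives 5 or [n]. *)
Lemma total_fix_pointwise w :
  (total_fix k (altw true w))%:R <= #|GLt|%:R *
    ((counts_ge setT 1 w && ~~ counts_ge setT 2 w)%:R + 2%:R * (counts_ge setT 2 w && ~~ counts_ge setT 3 w)%:R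
     + \sum_(I : {set L}) pairW I [seq x <- w | x \in I] * restW I [seq x <- w | x \notin I]).
Proof.
set S := \sum_I _; have S0 : 0 <= S.
  by apply: sumr_ge0 => I _; rewrite mulr_ge0 ?pairW_ge0 ?restW_ge0.
have le_c (c : nat) (B : algC) : (total_fix k (altw true w) <= c * #|GLt|)%N -> c%:R <= B ->
    (total_fix k (altw true w))%:R <= #|GLt|%:R * B.
  move=> h1 h2; apply: (@le_trans _ _ (c * #|GLt|)%:R); first by rewrite ler_nat.
  by rewrite mulnC natrM ler_wpM2l ?ler0n.
have ok1 : counts_ge setT 1 w by apply/forall_inP => x _; rewrite /zero_or_ge lt0n orbN.
rewrite ok1; have [ok2|/not_counts_ge[x _ cx]] := boolP (counts_ge setT 2 w); last first.
  apply: (le_c 1%N); last by rewrite /= mulr0 addr0 lerDl.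
  rewrite mul1n; apply: (total_fix_once k2 (j := x)); rewrite unzip1_altw; lia.
rewrite /= add0r; pose I := [set x | count_mem x w == 2].
have cI x : x \in I -> count_mem x w = 2%N by rewrite inE => /eqP.
have [hnc|hnc] := boolP (stack_nc [::] [seq x <- w | x \in I]); last first.
  have [|||||x [y [p1 [p2 [r [ew xp cy cyw]]]]]] //:= @nc_crossing _ I w [::] [::] w erefl erefl hnc.
  apply: (le_c 2%N).
    by apply: (total_fix_crossing (x := x) (y := y) k2 _ xp cy); rewrite unzip1_altw.
  suff -> : counts_ge setT 3 w = false by rewrite /= mulr1 lerDl.
  by apply/negbTE/negP => /forall_inP/(_ y); rewrite inE cyw => /(_ isT).
have dg : multiplicities I [::] [seq x <- w | x \in I].
  apply/forallP => x; rewrite count_mem_filter addn0.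
  by case xI: (x \in I) => //; rewrite cI.
have SI : restW I [seq x <- w | x \notin I] <= S.
  rewrite /S (bigD1 I) //= /pairW dg hnc mul1r lerDl.
  by apply: sumr_ge0 => J _; rewrite mulr_ge0 ?pairW_ge0 ?restW_ge0.
have ok3 : counts_ge (~: I) 3 [seq x <- w | x \notin I].
  apply/forall_inP => x; rewrite inE count_mem_filter => xI; rewrite xI mul1n.
  have := forall_inP ok2 x; rewrite inE => /(_ isT); rewrite /zero_or_ge => /orP[->//|c2].
  by apply/orP; right; rewrite ltn_neqAle c2 andbT eq_sym; move: xI; rewrite inE.
have S2 : restW I [seq x <- w | x \notin I] <=
    2%:R * (counts_ge setT 2 w && ~~ counts_ge setT 3 w)%:R + S.
  by apply: le_trans SI _; rewrite lerDr mulr_ge0 ?ler0n.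
rewrite ok2 /= in S2; move: S2; rewrite /restW ok3 /=.
have [ok4|/not_counts_ge[x xI cx]] := boolP (counts_ge (~: I) 4 _) => S2.
  by apply: (le_c n); [exact: total_fix_le |]; apply: le_trans S2; rewrite mulr0 mulr1 add0r.
apply: (le_c 5%N); last by apply: le_trans S2; rewrite mulr0 mulr1 addr0.
apply: (total_fix_triple k2 (j := x)); rewrite unzip1_altw.
have := forall_inP ok3 x xI; rewrite /zero_or_ge; move: cx; rewrite count_mem_filter.
by move: xI; rewrite inE => ->; rewrite mul1n; case: (count_mem x w) => [|[|[|[|]]]].
Qed.

Lemma sum_count w : (\sum_x count_mem x w = size w)%N.
Proof.
elim: w => [|y w IH] /=; first by rewrite big1.
rewrite big_split /= IH (bigD1 y) //= eqxx big1 ?addn0 ?add1n // => x.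
by rewrite eq_sym => /negPf ->.
Qed.

Lemma wsum_pairW I a : wsum I a (pairW I) <= (a == (2 * #|I|)%N)%:R * nc_count #|I| 0.
Proof.
have [->|ne] := eqVneq a (2 * #|I|)%N.
  rewrite mul1r; apply: (@wsum_nc _ I I [::]) => //; last by rewrite addn0.
  by apply/pred0P => x; rewrite /= andbF.
rewrite mul0r -(wsum0 I a) (eq_wsum (G := fun=> 0)) // => w sw _.
rewrite /pairW; have [/andP[/forallP d0 _]|//] := boolP (_ && _); case/eqP: ne.
rewrite -sw -sum_count (eq_bigr (fun x => (x \in I).*2)); last first.
  by move=> x _; rewrite (eqP (d0 x)) addn0.
rewrite (eq_bigr (fun x => 2 * (x \in I))%N) => [|x _]; last by rewrite mul2n.
rewrite -big_distrr /=; suff -> : #|I| = (\sum_x (x \in I))%N by [].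
by rewrite -sum1_card big_mkcond /=; apply: eq_bigr => x _; case: (x \in I).
Qed.

Definition restY l i : algC := 5%:R * Y 3 1 l (d - i) + n%:R * Y 4 0 l (d - i).

Lemma wsum_restW I l : wsum (~: I) l (restW I) = restY l #|I|.
Proof.
have cC : #|~: I| = (d - #|I|)%N by rewrite cardsCs setCK card_ord.
by rewrite /restW wsumD !wsumZ wsum_counts_ge1 // wsum_counts_ge0 // cC.
Qed.

Lemma wsum_restW_ge0 I l : 0 <= wsum (~: I) l (restW I).
Proof. by rewrite -(wsum0 (~: I) l); apply: ler_wsum => w _ _; apply: restW_ge0. Qed.

Lemma sum_sets (h : nat -> algC) :
  \sum_(I : {set L}) h #|I| = \sum_(0 <= i < d.+1) 'C(d, i)%:R * h i.
Proof.
rewrite big_mkord.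
have cI (I : {set L}) : (#|I| < d.+1)%N by rewrite ltnS -[leqRHS]card_ord max_card.
rewrite (partition_big (fun I : {set L} => Ordinal (cI I)) xpredT) //=.
apply: eq_bigr => i _.
rewrite (eq_bigr (fun=> h i)) => [|I /eqP <- //].
rewrite sumr_const -[LHS]mulr_natl; congr (_%:R * _).
have := card_draws L i; rewrite card_ord => <-; apply: eq_card => I.
by rewrite [RHS]inE.
Qed.

Lemma total_fix_sum l :
  wsum setT l (fun w => (total_fix k (altw true w))%:R) <= #|GLt|%:R *
   (Y 1 1 l d + 2%:R * Y 2 1 l d +
    \sum_(0 <= i < d.+1) 'C(d, i)%:R *
      ('C(l, 2 * i)%:R * nc_count i 0 * restY (l - 2 * i) i)).
Proof.
apply: le_trans (ler_wsum (fun w _ _ => total_fix_pointwise w)) _.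
rewrite wsumZ ler_wpM2l ?ler0n // !wsumD wsumZ !wsum_counts_ge1 // !cardsT card_ord.
rewrite lerD2l wsum_sum -(sum_sets (fun i => 'C(l, 2 * i)%:R * nc_count i 0 * restY (l - 2 * i) i)).
apply: ler_sum => I _; rewrite wsum_shuffle.
apply: le_trans (_ : \sum_(a < l.+1) 'C(l, a)%:R *
   ((nat_of_ord a == (2 * #|I|)%N)%:R * nc_count #|I| 0 * restY (l - a) #|I|) <= _).
  apply: ler_sum => a _; rewrite ler_wpM2l ?ler0n // -wsum_restW ler_wpM2r ?wsum_restW_ge0 //.
  exact: wsum_pairW.
have R0 : 0 <= 'C(l, 2 * #|I|)%:R * nc_count #|I| 0 * restY (l - 2 * #|I|) #|I|.
  apply: mulr_ge0; first by rewrite mulr_ge0 ?ler0n ?nc_count_ge0.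
  by rewrite -wsum_restW wsum_restW_ge0.
have [h|h] := ltnP (2 * #|I|) l.+1; last first.
  rewrite big1 // => a _; have /negPf -> : nat_of_ord a != (2 * #|I|)%N.
    by have := ltn_ord a; lia.
  by rewrite !mul0r mulr0.
rewrite (bigD1 (Ordinal h)) //= eqxx mul1r big1 ?addr0 ?mulrA // => a.
by rewrite -val_eqE /= => /negPf ->; rewrite !mul0r mulr0.
Qed.

End WordSum.

(** * * Power mean and conclusion *)

Lemma exprn_tangent (a M : algC) p : 0 <= a -> 0 <= M ->
  M ^+ p.+1 + p.+1%:R * M ^+ p * (a - M) <= a ^+ p.+1.
Proof.
move=> a0 M0; elim: p => [|p IH]; first by rewrite expr0 !expr1 !mul1r addrC subrK.
rewrite [leRHS]exprS; apply: le_trans (ler_wpM2l a0 IH).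
rewrite -subr_ge0.
have -> : a * (M ^+ p.+1 + p.+1%:R * M ^+ p * (a - M))
    - (M ^+ p.+2 + p.+2%:R * M ^+ p.+1 * (a - M)) = p.+1%:R * M ^+ p * (a - M) ^+ 2.
  by rewrite !exprS; ring.
apply: mulr_ge0; first by rewrite mulr_ge0 ?exprn_ge0 ?ler0n.
by rewrite real_exprn_even_ge0 // rpredB // ger0_real.
Qed.

(** Jensen's inequality: sum the tangent inequalities at the mean [M], whose linear terms cancel. *)
Lemma power_mean (T : finType) (S : {set T}) (a : T -> algC) p : (0 < #|S|)%N ->
    (forall s, s \in S -> 0 <= a s) ->
  (#|S|%:R^-1 * \sum_(s in S) a s) ^+ p.+1 <= #|S|%:R^-1 * \sum_(s in S) a s ^+ p.+1.
Proof.
move=> S0 a0; set M := _ * \sum_(s in S) a s.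
have M0 : 0 <= M by rewrite mulr_ge0 ?invr_ge0 ?ler0n // sumr_ge0.
have Sn : #|S|%:R != 0 :> algC by rewrite pnatr_eq0 -lt0n.
have eM : \sum_(s in S) a s = #|S|%:R * M by rewrite /M mulVKf.
rewrite ler_pdivlMl ?ltr0n //.
apply: (@le_trans _ _ (\sum_(s in S) (M ^+ p.+1 + p.+1%:R * M ^+ p * (a s - M)))).
  rewrite big_split /= -mulr_sumr sumrB eM !sumr_const -[M *+ _]mulr_natl subrr mulr0 addr0.
  by rewrite -[leRHS]mulr_natl.
by apply: ler_sum => s sS; apply: exprn_tangent => //; apply: a0.
Qed.

(** The right side keeps the form of the theorem: [(2 * i)! / 2 ^ i] words use each of [i] letters
    twice, and [2 ^ i / (i + 1)!] is the proportion of noncrossing ones among them. *)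
Lemma bin_nc_count l i : (2 * i <= l)%N ->
  'C(l, 2 * i)%:R * nc_count i 0 = (2%:R ^-1) ^+ i * l`!%:R / (l - 2 * i)`!%:R * (2%:R ^+ i / (i.+1)`!%:R).
Proof.
move=> h; rewrite /nc_count mul1n !addn0 -(bin_fact h) exprVn.
have h1 := fact_neq0 (l - 2 * i); have h2 := fact_neq0 i.+1.
have h3 : 2%:R ^+ i != 0 :> algC by rewrite expf_neq0 // pnatr_eq0.
move: h1 h2 h3; move: (l - _)`! (i.+1)`! (2 * i)`! (_ ^+ i) => u v w z h1 h2 h3.
by rewrite !natrM; field; rewrite h1 h2 h3.
Qed.

Theorem theorem2 (k d m : nat) (hk : (2 <= k)%N) (hd : (1 <= d)%N)
  (hm : (1 <= m)%N) :
  E_mu2 k d <= bound k d m.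
Proof.
have GLt0 : (0 < #|GLtuples k d|)%N.
  apply/card_gt0P; exists [ffun=> 1%:M]; apply/GLtP => j; rewrite ffunE.
  exact: GL1.
have Gn : #|GLtuples k d|%:R != 0 :> algC by rewrite pnatr_eq0 -lt0n.
have mu0 s : s \in GLtuples k d -> 0 <= mu2 (schreier_adj s).
  by move=> sG; have [] := mu2_trace sG hd hk hm.
have E0 : 0 <= E_mu2 k d.
  by rewrite mulr_ge0 ?invr_ge0 ?ler0n // sumr_ge0 // => s _; apply: normr_ge0.
have m20 : (0 < 2 * m)%N by rewrite muln_gt0.
rewrite -(exprCK m20 E0) /bound; set z := (X in _ <= _.-root X).
(* Comparing roots requires nonnegative radicands, and [0 <= z] follows from this same
   inequality. *)
suff Ez : E_mu2 k d ^+ (2 * m) <= z.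
  have Ep : 0 <= E_mu2 k d ^+ (2 * m) by rewrite exprn_ge0.
  by rewrite ler_rootC // qualifE /= ?(le_trans Ep).
have -> : E_mu2 k d = #|GLtuples k d|%:R^-1 * \sum_(s in GLtuples k d) mu2 (schreier_adj s).
  by congr (_ * _); apply: eq_bigr => s sG; rewrite ger0_norm ?mu0.
rewrite -(prednK m20); apply: le_trans (power_mean _ GLt0 mu0) _; rewrite (prednK m20).
rewrite ler_pdivrMl ?ltr0n //.
pose W (s : {ffun 'I_d -> 'M['F_2]_k}) := wsum setT (2 * m) (fun w : seq 'I_d => (fixpts (word_mx s (altw true w)))%:R).
have leW : \sum_(s in GLtuples k d) mu2 (schreier_adj s) ^+ (2 * m)
    <= \sum_(s in GLtuples k d) (d%:R ^- (2 * m) * W s - 1).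
  by apply: ler_sum => s sG; have [] := mu2_trace sG hd hk hm.
apply: le_trans leW _; rewrite sumrB -mulr_sumr sumr_const.
have -> : \sum_(s in GLtuples k d) W s = wsum setT (2 * m) (fun w : seq 'I_d => (total_fix k (altw true w))%:R).
  rewrite /W -wsum_sum; apply: eq_wsum => w _ _; by rewrite natr_sum.
rewrite /z mulrBr mulr1 lerD2r.
have D0 : 0 <= d%:R ^- (2 * m) :> algC by rewrite invr_ge0 exprn_ge0 ?ler0n.
apply: le_trans (ler_wpM2l D0 (total_fix_sum d hk (2 * m))) _.
rewrite mulrCA ler_wpM2l ?ler0n // exprVn -mulrA ler_wpM2l //.
have nn : (2 ^ k - 1)%:R != 0 :> algC.
  by rewrite pnatr_eq0 -lt0n; apply: ltn_trans (nz_gt1 hk).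
rewrite le_eqVlt; apply/orP; left; apply/eqP.
pose g i : algC := 'C(d, i)%:R * ('C(2 * m, 2 * i)%:R * nc_count i 0 * restY k d (2 * m - 2 * i) i).
have -> : \sum_(0 <= i < d.+1) 'C(d, i)%:R *
   ('C(2 * m, 2 * i)%:R * nc_count i 0 * restY k d (2 * m - 2 * i) i) = \sum_(0 <= i < m.+1) g i.
  (* Set sizes range up to [d] while the bound sums up to [m]; one of the two binomials vanishes on
     the difference. *)
  have out1 i : (m < i)%N -> g i = 0.
    by move=> h; rewrite /g [X in X%:R * _ * _]bin_small ?mul0r ?mulr0 // ltn_pmul2l.
  have out2 i : (d < i)%N -> g i = 0.
    by move=> h; rewrite /g bin_small // mul0r.
  have [h|h] := leqP m.+1 d.+1.
    by apply/esym/sum_nat_widen0 => // i /andP[/out1].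
  by apply: sum_nat_widen0 => [|i /andP[/out2]]; first exact: ltnW.
(* The term [i = 0], with no paired letter, yields the separate contributions of [y3(0)] and
   [y4(0)]. *)
rewrite big_ltn // /g.
have -> : nc_count 0 0 = 1 by rewrite /nc_count !fact0 divr1.
rewrite !muln0 !bin0 !mul1r /restY !subn0.
under eq_big_nat => i /andP[_ im] do rewrite bin_nc_count ?leq_mul2l //.
rewrite -/(nzcount k) in nn *.
have -> : \sum_(1 <= i < m.+1) 'C(d, i)%:R *
    ((2^-1 ^+ i * (2 * m)`!%:R / (2 * m - 2 * i)`!%:R * (2 ^+ i / (i.+1)`!%:R)) *
     (5 * Y 3 1 (2 * m - 2 * i) (d - i) + (nzcount k)%:R * Y 4 0 (2 * m - 2 * i) (d - i)))
  = (nzcount k)%:R * \sum_(1 <= i < m.+1) 'C(d, i)%:R * 2^-1 ^+ i * (2 * m)`!%:R / (2 * m - 2 * i)`!%:R *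
      (2 ^+ i / (i.+1)`!%:R) *
      (Y 3 1 (2 * m - 2 * i) (d - i) * 5 / (nzcount k)%:R + Y 4 0 (2 * m - 2 * i) (d - i)) :> algC.
  rewrite mulr_sumr; apply: eq_bigr => i _.
  have aux (c h f q t y3 y4 N : algC) : N != 0 ->
    c * ((h * f * q * t) * (5 * y3 + N * y4)) = N * (c * h * f * q * t * (y3 * 5 / N + y4)).
    by move=> N0; field.
  exact: aux.
move: (Y 1 1 _ _) (Y 2 1 _ _) (Y 3 1 _ _) (Y 4 0 _ _) (\sum_(_ <= _ < _) _) => y1 y2 y3 y4 S.
by field.
Qed.
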